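(* Consider the PD3O algorithm with constant stepsizes $\gamma_k\equiv\gamma\in(0,2/L_F)$ and with $\eta\geq\|K\|^2$. Then $x^k$ and $u^k$ converge to some solutions $x^\star$ and $u^\star$ of the primal problem $\min_{x\in\mathcal{X}}\Psi(x)$ and of the dual problem $\min_{u\in\mathcal{U}} (F+R)^*(-K^*u)+H^*(u)$, respectively. In addition, suppose that $H$ is continuous on an open ball centered at $Kx^\star$. Then the following hold: (i) $\Psi(x^k)-\Psi(x^\star)=o(1/\sqrt{k})$. (ii) Defining the weighted ergodic iterate $\bar{x}^k=\frac{2}{k(k+1)}\sum_{i=1}^k i\,x^i$ for every $k\geq 1$, one has $\Psi(\bar{x}^k)-\Psi(x^\star)=O(1/k)$. (iii) Furthermore, if $H$ is $L$-smooth for some $L>0$, then $\min_{i=1,\ldots,k}\Psi(x^i)-\Psi(x^\star)=o(1/k)$.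
   Context: $\mathcal{X}$ and $\mathcal{U}$ are finite-dimensional real Hilbert spaces, $K:\mathcal{X}\to\mathcal{U}$ is a linear operator with adjoint $K^*$ and operator norm $\|K\|$. $R:\mathcal{X}\to\mathbb{R}\cup\{+\infty\}$ and $H:\mathcal{U}\to\mathbb{R}\cup\{+\infty\}$ are proper, closed, convex functions, and $F:\mathcal{X}\to\mathbb{R}$ is convex and $L_F$-smooth for some $L_F>0$. A function is $L$-smooth if it is differentiable with $L$-Lipschitz continuous gradient. Set $\Psi(x)=F(x)+R(x)+H(Kx)$. For a function $G$, $G^*$ is its convex conjugate and $\mathrm{prox}_G(z)=\arg\min_{z'}\{G(z')+\frac12\|z-z'\|^2\}$. Standing assumption: there exists $x^\star\in\mathcal{X}$ such that $0\in\nabla F(x^\star)+\partial R(x^\star)+K^*\partial H(Kx^\star)$. PD3O algorithm: given positive stepsizes $(\gamma_k)_{k\in\mathbb{N}}$, $\eta>0$ with $\eta\geq\|K\|^2$, $q^0\in\mathcal{X}$, $u^0\in\mathcal{U}$, for $k=0,1,\ldots$ iterate $$x^{k+1}=\mathrm{prox}_{\gamma_k R}\big(\gamma_k(q^k-K^*u^k)\big),\qquad q^{k+1}=\tfrac{1}{\gamma_{k+1}}x^{k+1}-\nabla F(x^{k+1}),$$ $$u^{k+1}=\mathrm{prox}_{H^*/(\gamma_{k+1}\eta)}\Big(u^k+\tfrac1\eta K\big(\tfrac{1}{\gamma_k}x^{k+1}+q^{k+1}-q^k\big)\Big).$$ *)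

(* Defs.v *)
From HB Require Import structures.
From mathcomp Require Import all_boot all_order all_algebra.
From mathcomp Require Import all_classical all_reals all_analysis.

Set Implicit Arguments.
Unset Strict Implicit.
Unset Printing Implicit Defensive.

Import Order.TTheory GRing.Theory Num.Theory.
Import numFieldNormedType.Exports.

Local Open Scope classical_set_scope.
Local Open Scope ring_scope.

(* A finite-dimensional real Hilbert space.  Positive definiteness of the inner
   product follows from [normE2], completeness from the finite dimension. *)
HB.mixin Record NormedVector_isEuclidean (R : realType) V
    & NormedModule R V & Vector R V := {
  inner : V -> V -> R ;
  innerC : forall x y, inner x y = inner y x ;
  innerDl : forall x y z, inner (x + y) z = inner x z + inner y z ;
  innerZl : forall (a : R) x y, inner (a *: x) y = a * inner x y ;
  normE2 : forall x, `|x| ^+ 2 = inner x x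
}.

#[short(type="euclideanType")]
HB.structure Definition Euclidean (R : realType) :=
  {V of NormedModule R V & Vector R V & NormedVector_isEuclidean R V}.

Notation "''[' x , y ]" := (inner x y) : ring_scope.

Definition opnorm (R : realType) (X U : euclideanType R)
    (K : {linear X -> U}) : R :=
  sup [set `|K x| | x in [set x : X | `|x| <= 1]].

(* The default value [0] in [adjoint] and [gradient] is never used: see
   [adjointP] and [gradientP]. *)
Definition adjoint (R : realType) (X U : euclideanType R)
    (K : {linear X -> U}) (u : U) : X :=
  xget 0 [set y | forall x, '[K x, u] = '[x, y]].

Definition gradient (R : realType) (X : euclideanType R)
    (F : X -> R) (x : X) : X :=
  xget 0 [set g | forall d, 'd (F : X -> R^o) x d = '[g, d]].

Lemma riesz (R : realType) (X : euclideanType R) (phi : X -> R) :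
  (forall a x y, phi (a *: x + y) = a * phi x + phi y) ->
  exists g : X, forall x, phi x = '[g, x].
Proof.
move=> phiL; pose n := \dim (fullv : {vspace X}).
pose e (i : 'I_n) : X := (vbasis (fullv : {vspace X}))`_i.
have sumE (f : X -> R) (fL : forall a x y, f (a *: x + y) = a * f x + f y) x :
    f x = \sum_i coord (vbasis fullv) i x * f (e i).
  pose flin := GRing.isLinear.Build _ _ _ _ f fL.
  pose fl : {linear X -> R^o} := HB.pack f flin.
  rewrite {1}(coord_vbasis (memvf x)) -[f _]/(fl _) linear_sum.
  by apply: eq_bigr => i _; rewrite linearZ.
pose T (g : X) : 'rV[R]_n := \row_i '[g, e i].
have TL : linear T.
  by move=> a g g'; apply/rowP => i; rewrite !mxE innerDl innerZl.
pose Tlin := GRing.isLinear.Build _ _ _ _ T TL.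
pose Tl : {linear X -> 'rV[R]_n} := HB.pack T Tlin.
have T0 : lker (linfun Tl) == 0%VS.
  apply/lker0P => x y; rewrite !lfunE/= => /rowP Txy.
  have Txy0 z : '[x - y, z] = 0.
    rewrite innerC (sumE (fun z => '[z, x - y])); last first.
      by move=> a y1 y2; rewrite innerDl innerZl.
    apply: big1 => i _; have := Txy i; rewrite !mxE => xye.
    by rewrite innerC innerDl -scaleN1r innerZl xye mulN1r subrr mulr0.
  by apply/eqP; rewrite -subr_eq0 -normr_eq0 -sqrf_eq0 normE2 Txy0.
have Tsurj : limg (linfun Tl) = fullv.
  apply/eqP; rewrite eqEdim subvf limg_dim_eq ?(eqP T0) ?capv0//.
  by rewrite dimvf /dim/= mul1n.
have /memv_imgP[g _ gE] : \row_i phi (e i) \in limg (linfun Tl).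
  by rewrite Tsurj memvf.
exists g => x; rewrite (sumE phi phiL) innerC (sumE (fun z => '[z, g])).
  by apply: eq_bigr => i _; move/rowP/(_ i): gE; rewrite lfunE !mxE innerC => ->.
by move=> a z z'; rewrite innerDl innerZl.
Qed.

Lemma adjointP (R : realType) (X U : euclideanType R) (K : {linear X -> U})
  (x : X) (u : U) : '[K x, u] = '[x, adjoint K u].
Proof.
rewrite /adjoint; case: xgetP => [y _ /(_ x)//|noadj]; exfalso.
have [|g gE] := @riesz R X (fun y => '[K y, u]).
  by move=> a y z; rewrite linearP innerDl innerZl.
by apply: (noadj g) => y; rewrite gE innerC.
Qed.

Lemma gradientP (R : realType) (X : euclideanType R) (F : X -> R) (x d : X) :
  'd (F : X -> R^o) x d = '[gradient F x, d].
Proof.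
rewrite /gradient; case: xgetP => [y _ /(_ d)//|nograd]; exfalso.
have [g gE] := @riesz R X ('d (F : X -> R^o) x) (linearP _).
exact: nograd gE.
Qed.

Definition L_smooth (R : realType) (X : euclideanType R) (L : R) (F : X -> R) :=
  (forall x, differentiable (F : X -> R^o) x) /\ L.-lipschitz (gradient F).

Definition proper_fun (R : realType) (T : Type) (f : T -> \bar R) :=
  (forall x, f x != -oo%E) /\ exists x, f x != +oo%E.

Definition closed_fun (R : realType) (X : euclideanType R) (f : X -> \bar R) :=
  closed [set p : X * R^o | (f p.1 <= p.2%:E)%E].

Definition econvex (R : realType) (X : euclideanType R) (f : X -> \bar R) :=
  forall (t : R) (x y : X), 0 < t < 1 ->
    (f (t *: x + (1 - t) *: y)%R <= t%:E * f x + (1 - t)%:E * f y)%E.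

Definition subdifferential (R : realType) (X : euclideanType R)
    (f : X -> \bar R) (x : X) : set X :=
  [set g | forall y, (f x + '[g, y - x]%:E <= f y)%E].

Definition conjugate (R : realType) (X : euclideanType R)
    (f : X -> \bar R) (p : X) : \bar R :=
  ereal_sup [set ('[p, x]%:E - f x)%E | x in [set: X]].

Definition argmin (R : realType) (T : Type) (f : T -> \bar R) : set T :=
  [set x | forall y, (f x <= f y)%E].

(* For [G] proper, closed and convex the minimiser exists and is unique, so the
   default value [0] is not used. *)
Definition prox (R : realType) (X : euclideanType R)
    (G : X -> \bar R) (z : X) : X :=
  xget 0 (argmin (fun y => (G y + (2^-1 * `|z - y| ^+ 2)%:E)%E)).

Definition primal_objective (R : realType) (X U : euclideanType R) (F : X -> R)
    (Reg : X -> \bar R) (H : U -> \bar R) (K : {linear X -> U}) (x : X) :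
    \bar R :=
  ((F x)%:E + Reg x + H (K x))%E.

Definition dual_objective (R : realType) (X U : euclideanType R) (F : X -> R)
    (Reg : X -> \bar R) (H : U -> \bar R) (K : {linear X -> U}) (u : U) :
    \bar R :=
  (conjugate (fun x => (F x)%:E + Reg x) (- adjoint K u)%R + conjugate H u)%E.

(* The algorithm does not define [x 0], which is left unconstrained. *)
Definition PD3O (R : realType) (X U : euclideanType R) (F : X -> R)
    (Reg : X -> \bar R) (H : U -> \bar R) (K : {linear X -> U})
    (gamma : nat -> R) (eta : R) (q0 : X) (u0 : U)
    (x q : nat -> X) (u : nat -> U) : Prop :=
  [/\ q 0%N = q0, u 0%N = u0 &
    forall k,
    [/\ x k.+1 = prox (fun y => (gamma k)%:E * Reg y)%E
                   (gamma k *: (q k - adjoint K (u k))),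
        q k.+1 = (gamma k.+1)^-1 *: x k.+1 - gradient F (x k.+1) &
        u k.+1 = prox (fun v => ((gamma k.+1 * eta)^-1)%:E * conjugate H v)%E
                   (u k + eta^-1 *:
                      K ((gamma k)^-1 *: x k.+1 + q k.+1 - q k))]].

(* Landau relations for sequences that may take infinite values at finitely
   many indices; the first conjunct is needed because [fine] maps infinities
   to [0]. *)
Definition elittleo (R : realType) (f : nat -> \bar R) (g : nat -> R) : Prop :=
  (\forall k \near \oo, f k \is a fin_num) /\
  (fun k => fine (f k) : R^o) =o_\oo (fun k => g k : R^o).

Definition ebigO (R : realType) (f : nat -> \bar R) (g : nat -> R) : Prop :=
  (\forall k \near \oo, f k \is a fin_num) /\
  (fun k => fine (f k) : R^o) =O_\oo (fun k => g k : R^o).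

(* Main.v *)
Require Import Defs.
From HB Require Import structures.
From mathcomp Require Import all_boot all_order all_algebra.
From mathcomp Require Import all_classical all_reals all_analysis.
From mathcomp Require Import zify ring lra.

(** The proof treats PD3O as an averaged fixed-point iteration, in the spirit of
    Davis-Yin splitting, and reads all the rates off one energy.

    The change of variable [a = q - K* u] turns the iteration into a map on pairs
    [(a, u)].  The optimality conditions of the two proximal steps say that
    [a - x / gamma] is a subgradient of [R] at [x], and that the new [u] is a
    subgradient of [H] at a point [w] which differs from [K x] by a multiple of
    the increment of [(a, u)] ([pd3o_step]).  The right metric is the seminorm
    [|a|^2 + <(eta - K K* ) u, u>] ([energy]): in the difference of two
    trajectories all the couplings through [K] then cancel
    ([energy_identity]), and what remains are inner products that are
    nonnegative by monotonicity of the subdifferentials and of the gradient.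
    Cocoercivity of the gradient ([gradient_cocoercive]) together with
    [gamma < 2 / L_F] yields [energy_contract]: the energy distance of two
    trajectories decreases at least by a fraction of the energy of the
    difference of their increments.

    Compared with a fixed trajectory, this makes the energy of the increments
    summable; compared with its own shift, it makes it nonincreasing.  Hence
    [k] times the energy of the [k]-th increment tends to zero
    ([nonincreasing_rate_o]).  The iterates are bounded in spite of the possible
    degeneracy of the energy, because proximal points are controlled by it
    ([primal_le_energy], [dual_le_energy]); a limit point is a fixed point since
    subdifferentials have closed graphs, and the distance to that fixed point is
    nonincreasing, so that the whole sequence converges ([iterates_cvg]).  Fixed
    points are solutions of the primal problem ([at_rest_argmin]) and, through
    equality in the Fenchel-Young inequalities, of the dual one
    ([fenchel_dual_argmin]).

    For the rates, the subgradient inequalities bound the gap of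
    [F x + R x + H w] by inner products with the increment ([value_gap]), and [H]
    is transported from [w] to [K x] by a local Lipschitz estimate
    ([convex_lipschitz]).  For the last iterate the bound is the square root of
    the energy of the increment, hence (i).  For (ii), the gap is also bounded
    by a telescoping difference of energies ([value_gap_telescope]), and so is
    [K x - w]; summation by parts against the weights [1, 2, ...] leaves a term of
    order [k], to be divided by [k (k + 1) / 2].  For (iii), smoothness of [H]
    makes the gradients of [H] cocoercive, so that the squared distances of the
    dual iterates to the solution are summable; then so are the gaps of the
    objective ([smooth_gap_summable]), and a nonincreasing summable sequence,
    such as the running minimum of the gaps, is [o(1 / k)]. *)

Set Implicit Arguments.
Unset Strict Implicit.
Unset Printing Implicit Defensive.

Import Order.TTheory GRing.Theory Num.Theory.
Import numFieldNormedType.Exports.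
Local Open Scope classical_set_scope.
Local Open Scope ring_scope.

(** * Euclidean spaces *)

Section InnerProduct.
Context {R : realType} {X : euclideanType R}.
Implicit Types (x y z : X) (c : R).

Lemma innerDr x y z : '[x, y + z] = '[x, y] + '[x, z].
Proof. by rewrite innerC innerDl ![inner _ x]innerC. Qed.

Lemma innerZr c x y : '[x, c *: y] = c * '[x, y].
Proof. by rewrite innerC innerZl innerC. Qed.

Lemma innerNl x y : '[- x, y] = - '[x, y].
Proof. by rewrite -scaleN1r innerZl mulN1r. Qed.

Lemma innerNr x y : '[x, - y] = - '[x, y].
Proof. by rewrite innerC innerNl innerC. Qed.

Lemma innerBl x y z : '[x - y, z] = '[x, z] - '[y, z].
Proof. by rewrite innerDl innerNl. Qed.

Lemma innerBr x y z : '[x, y - z] = '[x, y] - '[x, z].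
Proof. by rewrite innerDr innerNr. Qed.

Lemma inner0l x : '[0, x] = 0.
Proof. by rewrite -(scale0r 0) innerZl mul0r. Qed.

Lemma inner0r x : '[x, 0] = 0.
Proof. by rewrite innerC inner0l. Qed.

Definition innerE :=
  (@innerDl R X, innerDr, innerBl, innerBr, innerNl, innerNr,
   @innerZl R X, innerZr).

Lemma inner_ge0 x : 0 <= '[x, x].
Proof. by rewrite -normE2 sqr_ge0. Qed.

Lemma sqr_normD x y : `|x + y| ^+ 2 = `|x| ^+ 2 + 2 * '[x, y] + `|y| ^+ 2.
Proof. by rewrite !normE2 !innerE (innerC y x); ring. Qed.

Lemma sqr_normB x y : `|x - y| ^+ 2 = `|x| ^+ 2 - 2 * '[x, y] + `|y| ^+ 2.
Proof. by rewrite !normE2 !innerE (innerC y x); ring. Qed.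

Lemma cauchy_schwarz x y : '[x, y] <= `|x| * `|y|.
Proof.
have [->|x0] := eqVneq x 0; first by rewrite inner0l normr0 mul0r.
have xp : 0 < `|x| by rewrite normr_gt0.
have : 0 <= `| `|y| *: x - `|x| *: y| ^+ 2 by exact: sqr_ge0.
rewrite sqr_normB !innerE !normrZ !normr_id => h.
have {}h : 0 <= 2 * (`|x| * `|y|) * (`|x| * `|y| - '[x, y]).
  by apply: le_trans h _; rewrite le_eqVlt; apply/orP; left; apply/eqP; ring.
have [->|y0] := eqVneq y 0; first by rewrite inner0r normr0 mulr0.
have yp : 0 < `|y| by rewrite normr_gt0.
by move: h; rewrite pmulr_rge0 ?subr_ge0// !mulr_gt0.
Qed.

Lemma young c x y : 0 < c -> 2 * '[x, y] <= c * `|x| ^+ 2 + c^-1 * `|y| ^+ 2.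
Proof.
move=> c0; have : 0 <= c^-1 * `|c *: x - y| ^+ 2.
  by rewrite mulr_ge0 ?sqr_ge0// invr_ge0 ltW.
rewrite sqr_normB !innerE normrZ (gtr0_norm c0) exprMn.
rewrite -subr_ge0 => h; rewrite -subr_ge0; apply: le_trans h _.
rewrite le_eqVlt; apply/orP; left; apply/eqP; field; exact: lt0r_neq0.
Qed.

Lemma norm_inner_le x y : `|'[x, y]| <= `|x| * `|y|.
Proof.
rewrite ler_norml cauchy_schwarz andbT -(normrN x) lerNl -innerNl.
exact: cauchy_schwarz.
Qed.

Lemma cvg_norm_le (x_ : nat -> X) (e_ : nat -> R) x :
  (forall k, `|x_ k - x| <= e_ k) -> e_ @ \oo --> (0 : R) -> x_ @ \oo --> x.
Proof.
move=> xe e0; apply/cvgrPdist_le => e ep.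
move/cvgrPdist_le : e0 => /(_ e ep); apply: filterS => k.
rewrite sub0r normrN => ke; rewrite distrC; apply: le_trans (xe k) _.
exact: le_trans (ler_norm _) ke.
Qed.

Lemma cvg_norm_sub (x_ : nat -> X) x :
  x_ @ \oo --> x -> (fun k => `|x_ k - x|) @ \oo --> (0 : R).
Proof.
move=> h; rewrite -[0]/(0 : R) -(@normr0 _ X) -(subrr x).
apply: cvg_norm; apply: cvgB => //; exact: cvg_cst.
Qed.

Lemma cvg_inner (x_ y_ : nat -> X) x y : x_ @ \oo --> x -> y_ @ \oo --> y ->
  (fun k => '[x_ k, y_ k]) @ \oo --> '[x, y].
Proof.
move=> hx hy.
have e0 : (fun k => `|x_ k - x| * `|y_ k - y| + `|x| * `|y_ k - y|
    + `|x_ k - x| * `|y|) @ \oo --> (0 : R).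
  have ex := cvg_norm_sub hx; have ey := cvg_norm_sub hy.
  rewrite -[0](_ : 0 * 0 + `|x| * 0 + 0 * `|y| = 0); last by ring.
  apply: cvgD; first apply: cvgD.
  - exact: cvgM.
  - by apply: cvgM => //; exact: cvg_cst.
  - by apply: cvgM => //; exact: cvg_cst.
apply/cvgrPdist_le => e ep.
move/cvgrPdist_le : e0 => /(_ e ep); apply: filterS => k.
rewrite sub0r normrN => ke; rewrite distrC.
apply: le_trans (le_trans (ler_norm _) ke).
rewrite (_ : '[x_ k, y_ k] - '[x, y] = '[x_ k - x, y_ k - y]
    + '[x, y_ k - y] + '[x_ k - x, y]); last by rewrite !innerE; ring.
apply: le_trans (ler_normD _ _) _; apply: lerD; last exact: norm_inner_le.
by apply: le_trans (ler_normD _ _) _; apply: lerD; exact: norm_inner_le.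
Qed.

Lemma inner_ext y z : (forall x, '[x, y] = '[x, z]) -> y = z.
Proof.
move=> yz; apply/eqP; rewrite -subr_eq0 -normr_eq0 -sqrf_eq0 normE2.
by rewrite innerBr yz subrr.
Qed.

Lemma sqr_norm4 (v1 v2 v3 v4 : X) :
  `|v1 + v2 + v3 + v4| ^+ 2 <=
  4 * (`|v1| ^+ 2 + `|v2| ^+ 2 + `|v3| ^+ 2 + `|v4| ^+ 2).
Proof.
have h (s t : X) : `|s + t| ^+ 2 <= 2 * `|s| ^+ 2 + 2 * `|t| ^+ 2.
  rewrite sqr_normD; have := young s t ltr01; rewrite invr1 !mul1r.
  by move: (Num.norm s ^+ 2) (Num.norm t ^+ 2) (inner _ _) => *; lra.
rewrite -addrA; have := h (v1 + v2) (v3 + v4); have := h v1 v2; have := h v3 v4.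
move: (Num.norm (v1 + v2 + (v3 + v4)) ^+ 2) (Num.norm (v1 + v2) ^+ 2).
move: (Num.norm (v3 + v4) ^+ 2) (Num.norm v1 ^+ 2) (Num.norm v2 ^+ 2).
by move: (Num.norm v3 ^+ 2) (Num.norm v4 ^+ 2) => *; lra.
Qed.

Lemma cvg_sqr_norm (z : nat -> X) (l : X) (C : R) (v : nat -> R) :
  (forall k, `|z k - l| ^+ 2 <= C * v k) ->
  v @ \oo --> (0 : R) -> z @ \oo --> l.
Proof.
move=> zv v0; have Cv0 : (fun k => C * v k) @ \oo --> (0 : R).
  by rewrite -[0](mulr0 C); apply: cvgM => //; exact: cvg_cst.
apply/cvgrPdist_le => e e0; have e2 : 0 < e ^+ 2 by rewrite exprn_gt0.
move/cvgrPdist_le : Cv0 => /(_ _ e2); apply: filterS => k.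
rewrite sub0r normrN distrC => ke.
rewrite -ler_sqr ?nnegrE ?(ltW e0)//.
by apply: le_trans (zv k) _; apply: le_trans (ler_norm _) ke.
Qed.

Lemma norm_le_sqr (z l : X) (C : R) :
  `|z - l| ^+ 2 <= C -> `|z| <= `|l| + (1 + C).
Proof.
move=> zC; rewrite -{1}(subrK l z) addrC; apply: le_trans (ler_normD _ _) _.
rewrite lerD2l; move: zC; have := normr_ge0 (z - l).
by move: (Num.norm (z - l)) => t t0 tC; nra.
Qed.

End InnerProduct.

(* Reduces a goal about vectors to one about the real inner products of the
   vectors that it is made of.  The context is forgotten, so that the facts to
   be used have to be premises of the goal. *)
Ltac abstract_inner :=
  rewrite ?normE2 ?innerE;
  repeat match goal with
  | |- context [@inner ?R ?X ?x ?y] => generalize (@inner R X x y)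
  end;
  repeat match goal with H : _ |- _ => clear H end; move=> *.

(** Every vector is recovered from finitely many inner products: the
    coordinates in a basis are linear forms, hence inner products by the Riesz
    representation.  This is how finite dimension enters the proof. *)
Lemma euclidean_frame (R : realType) (X : euclideanType R) :
  exists (n : nat) (e g : 'I_n -> X), forall x, x = \sum_i '[g i, x] *: e i.
Proof.
pose n := \dim (fullv : {vspace X}).
exists n, (fun i => (vbasis (fullv : {vspace X}))`_i).
have /choice[g gE] (i : 'I_n) :
    exists g : X, forall x, coord (vbasis fullv) i x = '[g, x].
  by apply: riesz => a x y; rewrite linearP.
exists g => x; rewrite {1}(coord_vbasis (memvf x)).
by apply: eq_bigr => i _; rewrite gE.
Qed.

Lemma increasing_seq_ge (f : nat -> nat) :
  increasing_seq f -> forall k, (k <= f k)%N.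
Proof.
move=> fi; elim=> // k ih; apply: leq_ltn_trans ih _.
by move/increasing_seqP: fi => /(_ k).
Qed.

Lemma cvg_subseq (T : topologicalType) (f : nat -> nat) (u : nat -> T) (l : T) :
  (forall k, (k <= f k)%N) -> u @ \oo --> l -> (u \o f) @ \oo --> l.
Proof.
move=> fk ul; apply: cvg_comp ul => A [N _ NA]; exists N => // k /= Nk.
by apply: NA => /=; exact: leq_trans Nk (fk k).
Qed.

(** Bolzano-Weierstrass, one coordinate of [euclidean_frame] after the other. *)
Lemma bounded_euclidean_subseq (R : realType) (X : euclideanType R)
    (x : nat -> X) (M : R) : (forall k, `|x k| <= M) ->
  exists2 f : nat -> nat, forall k, (k <= f k)%N &
    exists l : X, (x \o f) @ \oo --> l.
Proof.
move=> xM; have [n [e [g xE]]] := euclidean_frame X.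
have M0 : 0 <= M by apply: le_trans (xM 0%N).
have coords (m : nat) : (m <= n)%N -> exists2 f : nat -> nat,
    forall k, (k <= f k)%N &
    forall i : 'I_n, (i < m)%N -> cvgn (fun k => '[g i, x (f k)]).
  elim: m => [_|m ih mn]; first by exists id.
  have [f fk fc] := ih (ltnW mn); pose j := Ordinal mn.
  have bj : bounded_fun (fun k => '[g j, x (f k)] : R^o).
    exists (`|g j| * M); split; first exact: num_real.
    move=> y gy k _ /=; apply: le_trans (norm_inner_le _ _) _.
    by apply: le_trans (ltW gy); exact: ler_wpM2l.
  have [h hi hc] := bolzano_weierstrass bj.
  have hk := increasing_seq_ge hi.
  exists (f \o h) => [k|i]; first by apply: leq_trans (hk k) (fk _).
  rewrite ltnS leq_eqVlt => /predU1P[ij|im].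
    by rewrite (_ : i = j) //; exact: val_inj.
  have /cvg_ex[l lc] := fc i im; apply/cvg_ex; exists l.
  exact: cvg_subseq hk lc.
have [f fk fc] := coords n (leqnn n); exists f => //.
exists (\sum_i lim ((fun k => '[g i, x (f k)]) @ \oo) *: e i).
rewrite (_ : x \o f = fun k => \sum_i '[g i, x (f k)] *: e i); last first.
  by apply/funext => k; exact: xE.
elim: (index_enum _) => [|i r ih].
  rewrite big_nil (_ : (fun k => _) = cst 0); first exact: cvg_cst.
  by apply/funext => k; rewrite big_nil.
rewrite big_cons (_ : (fun k => _) = fun k => '[g i, x (f k)] *: e i
    + \sum_(j <- r) '[g j, x (f k)] *: e j); last first.
  by apply/funext => k; rewrite big_cons.
apply: cvgD ih; apply: cvgZ; last exact: cvg_cst.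
exact: fc.
Qed.

(** * Bounded operators and the adjoint *)

Section Operator.
Context {R : realType} {X U : euclideanType R} (K : {linear X -> U}).

Fact adjoint_is_linear : linear (adjoint K).
Proof.
move=> a u v; apply: inner_ext => x.
by rewrite -adjointP !innerE -!adjointP.
Qed.

HB.instance Definition _ :=
  GRing.isLinear.Build R U X *:%R (adjoint K) adjoint_is_linear.

Lemma linear_bounded : exists2 C : R, 0 <= C & forall x, `|K x| <= C * `|x|.
Proof.
have [n [e [g xE]]] := euclidean_frame X.
exists (\sum_i `|g i| * `|K (e i)|) => [|x].
  by apply: sumr_ge0 => i _; exact: mulr_ge0.
rewrite {1}(xE x) linear_sum mulr_suml; apply: le_trans (ler_norm_sum _ _ _) _.
apply: ler_sum => i _; rewrite linearZ normrZ mulrAC.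
by apply: ler_wpM2r => //; exact: norm_inner_le.
Qed.

Lemma opnorm_ub x : `|x| <= 1 -> `|K x| <= opnorm K.
Proof.
move=> x1; have [C C0 KC] := linear_bounded.
apply: ub_le_sup; last by exists x.
exists C => _ /= [y y1 <-]; apply: le_trans (KC y) _.
by rewrite -[leRHS]mulr1; exact: ler_wpM2l.
Qed.

Lemma opnorm_ge0 : 0 <= opnorm K.
Proof. by apply: le_trans (opnorm_ub (x := 0) _); rewrite ?normr0. Qed.

Lemma opnorm_le x : `|K x| <= opnorm K * `|x|.
Proof.
have [->|x0] := eqVneq x 0; first by rewrite linear0 !normr0 mulr0.
have xp : 0 < `|x| by rewrite normr_gt0.
rewrite -ler_pdivrMr// [leLHS](_ : _ = `|K (`|x|^-1 *: x)|); last first.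
  by rewrite linearZ normrZ normfV normr_id mulrC.
by apply: opnorm_ub; rewrite normrZ normfV normr_id mulVf// gt_eqF.
Qed.

(** Because [|K* u|^2] is the inner product of [K (K* u)] and [u]. *)
Lemma adjoint_norm_le u : `|adjoint K u| <= opnorm K * `|u|.
Proof.
have [->|v0] := eqVneq (adjoint K u) 0.
  by rewrite normr0 mulr_ge0 ?opnorm_ge0.
have vp : 0 < `|adjoint K u| by rewrite normr_gt0.
rewrite -(ler_pM2l vp) -expr2 normE2 -adjointP.
apply: le_trans (cauchy_schwarz _ _) _.
by rewrite mulrCA mulrA; apply: ler_wpM2r => //; exact: opnorm_le.
Qed.

Lemma cvg_linear (x_ : nat -> X) (x : X) : x_ @ \oo --> x ->
  (fun k => K (x_ k)) @ \oo --> K x.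
Proof.
move=> xx; apply: (@cvg_norm_le _ _ _ (fun k => opnorm K * `|x_ k - x|)).
  by move=> k; rewrite -linearB; exact: opnorm_le.
rewrite -(mulr0 (opnorm K)); apply: cvgM; first exact: cvg_cst.
exact: cvg_norm_sub.
Qed.

End Operator.

(** * Smooth convex functions *)

Lemma econvex_EFin (R : realType) (X : euclideanType R) (F : X -> R) :
  convex_function setT (F : convex_lmodType X -> R^o) -> econvex (EFin \o F).
Proof.
move=> Fc t x y /andP[t0 t1].
have t01 : Itv.spec (@Itv.num_sem R) (Itv.Real `[0%Z, 1%Z]) t.
  by rewrite /= /Itv.num_sem/= in_itv/= num_real (ltW t0) (ltW t1).
have := Fc (Itv.mk t01) x y.
by rewrite !inE => /(_ I I); rewrite -!EFinM -EFinD lee_fin.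
Qed.

Section Smooth.
Context {R : realType} {X : euclideanType R} (F : X -> R) (dF : X -> X).
Hypothesis diffF : forall x, differentiable (F : X -> R^o) x.
(* [dF] stands for [gradient F]. *)
Hypothesis dFE : forall x d, 'd (F : X -> R^o) x d = '[dF x, d].

Lemma is_derive_line x d (t : R) :
  is_derive t 1 (fun s => F (x + s *: d) : R^o) '[dF (x + t *: d), d].
Proof.
have quotient_eq :
    (fun h : R => h^-1 *: (((fun s => F (x + s *: d) : R^o) \o shift t) (h *: 1)
                           - F (x + t *: d))) =
    (fun h : R => h^-1 *: (((F : X -> R^o) \o shift (x + t *: d)) (h *: d)
                           - F (x + t *: d))).
  apply/funext => h /=; congr (_ *: (F _ - _)).
  by rewrite -[h%:A]/(h * 1) mulr1 scalerDl addrCA.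
split.
  by rewrite /derivable quotient_eq; apply: diff_derivable; exact: diffF.
rewrite /derive quotient_eq -dFE -deriveE//.
Qed.

(** By convexity the difference quotients of [F] at [x] in the direction [y - x]
    with step in [(0, 1)] are at most [F y - F x]. *)
Lemma convex_gradient : econvex (EFin \o F) ->
  forall x y, F x + '[dF x, y - x] <= F y.
Proof.
move=> Fc x y; rewrite addrC -lerBrDr.
have [+ dE] := is_derive_line x (y - x) 0.
rewrite scale0r addr0 in dE; rewrite -dE.
move=> /cvg_dnbhs_at_right/cvgr_to_le; apply; near=> h.
have h0 : 0 < h by near: h; exact: nbhs_right_gt.
have h1 : h < 1 by near: h; exact: nbhs_right_lt.
rewrite /= scale0r !addr0 -[h%:A]/(h * 1) mulr1.
rewrite -[_ *: _]/(h^-1 * (F (x + h *: (y - x)) - F x)).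
rewrite mulrC ler_pdivrMr// mulrC.
have := Fc h y x; rewrite h0 h1 => /(_ isT).
rewrite /= -!EFinM -EFinD lee_fin.
rewrite (_ : h *: y + (1 - h) *: x = x + h *: (y - x)); first by lra.
by rewrite scalerBl scale1r scalerBr addrCA.
Unshelve. all: end_near. Qed.

Context (L : R) (L0 : 0 < L).
Hypothesis lipF : forall x y, `|dF x - dF y| <= L * `|x - y|.

(** On the segment from [x] to [y], the difference of [F] and of its quadratic
    model at [x] has a nonpositive derivative. *)
Lemma smooth_upper_bound x y :
  F y <= F x + '[dF x, y - x] + L / 2 * `|y - x| ^+ 2.
Proof.
set d := y - x; set A := '[dF x, d]; set B := L / 2 * `|d| ^+ 2.
pose f := (fun s => F (x + s *: d) : R^o) - (A \*: id) - (B \*: id ^+ 2)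
  : R -> R.
pose df s := '[dF (x + s *: d), d] - A - B * (2 * s) : R.
have fder (s : R) : is_derive s 1 f (df s).
  have Fd := is_derive_line x d s.
  apply: is_derive_eq; rewrite /df expr1.
  by rewrite /GRing.scale /= !mulr1.
have fc : {within `[0, 1], continuous f}.
  apply: continuous_subspaceT => s; apply: differentiable_continuous.
  by apply/derivable1_diffP; exact: ex_derive.
have [c /itvP c01 fE] := @MVT R f df 0 1 ltr01 (fun s _ => fder s) fc.
have : df c <= 0.
  rewrite /df /A -innerBl subr_le0; apply: le_trans (cauchy_schwarz _ _) _.
  apply: (@le_trans _ _ (L * `|c *: d| * `|d|)).
    apply: ler_wpM2r => //; apply: le_trans (lipF _ _) _.
    by rewrite addrC addKr.
  rewrite normrZ ger0_norm ?c01// /B.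
  by rewrite le_eqVlt; apply/orP; left; apply/eqP; field.
have -> : df c = f 1 - f 0 by rewrite fE subr0 mulr1.
rewrite /f !fctE /= !scale1r !scale0r addr0 -/d /GRing.scale /=.
by rewrite /d subrKC expr1n expr0n/= -/d; lra.
Qed.

(** The convex function [F - '[dF x, _]] has its minimum at [x].  Its value there
    is at most its value at [z], the minimiser of its upper quadratic model
    around [y], where the model lies below its value at [y] by the squared norm
    that appears in the statement. *)
Lemma convex_smooth_lower : econvex (EFin \o F) -> forall x y,
  F x + '[dF x, y - x]
    + (2 * L)^-1 * `|dF y - dF x| ^+ 2 <= F y.
Proof.
move=> Fc x y; set g := dF y - dF x.
pose z := y - L^-1 *: g.
have zy : z - y = - (L^-1 *: g) by rewrite /z addrC addKr.
have h1 := smooth_upper_bound y z; have h2 := convex_gradient Fc x z.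
rewrite zy normrN normrZ exprMn innerNr innerZr in h1.
rewrite (_ : z - x = (y - x) - L^-1 *: g) in h2; last by rewrite /z addrAC.
rewrite innerBr innerZr in h2.
have gg : `|g| ^+ 2 = '[dF y, g] - '[dF x, g].
  by rewrite normE2 /g innerBl.
have hL : L / 2 * (`|L^-1| ^+ 2 * `|g| ^+ 2) = (2 * L)^-1 * `|g| ^+ 2.
  rewrite gtr0_norm ?invr_gt0//; field; exact: lt0r_neq0.
have hL2 : L^-1 * `|g| ^+ 2 = 2 * ((2 * L)^-1 * `|g| ^+ 2).
  field; exact: lt0r_neq0.
rewrite gg mulrBr -gg in hL2; move: h1 h2 hL hL2; clearbody z g.
by move: (L^-1) ((2 * L)^-1) (F x) (F y) (F z); abstract_inner; lra.
Qed.

(** The Baillon-Haddad inequality, by adding the lower bound above to the one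
    with the two points exchanged. *)
Lemma gradient_cocoercive : econvex (EFin \o F) -> forall x y,
  L^-1 * `|dF x - dF y| ^+ 2
    <= '[dF x - dF y, x - y].
Proof.
move=> Fc x y; have h1 := convex_smooth_lower Fc x y.
have := convex_smooth_lower Fc y x.
rewrite -(opprB x y) innerNr -(distrC (dF x)) in h1.
have hL : L^-1 * `|dF x - dF y| ^+ 2 =
    2 * ((2 * L)^-1 * `|dF x - dF y| ^+ 2).
  field; exact: lt0r_neq0.
rewrite hL; move: h1 hL.
by move: ((2 * L)^-1) (F x) (F y); abstract_inner; lra.
Qed.

End Smooth.

Lemma L_smooth_lip (R : realType) (X : euclideanType R) (L : R) (F : X -> R) :
  L_smooth L F ->
  forall x y, `|gradient F x - gradient F y| <= L * `|x - y|.
Proof. by move=> [_ Flip] x y; exact: (Flip (x, y)). Qed.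

(** * Subdifferentials and proximal maps *)

Section Subdifferential.
Context {R : realType} {X : euclideanType R} (f : X -> \bar R).
Hypothesis f_proper : proper_fun f.
Implicit Types x y g : X.

Lemma subdiff_fin x g : subdifferential f x g -> f x \is a fin_num.
Proof.
case: f_proper => fN [y fy] xg.
have := xg y; rewrite fin_numE fN /=.
case: (f x) (fN x) => [//|_|//]; rewrite addye// leye_eq => /eqP fyE.
by rewrite fyE in fy.
Qed.

Lemma subdiff_ineq x g y (c : R) : subdifferential f x g -> f y = c%:E ->
  fine (f x) + '[g, y - x] <= c.
Proof.
by move=> xg fy; have := xg y; rewrite fy -(fineK (subdiff_fin xg)) -EFinD lee_fin.
Qed.

Lemma subdiff_monotone x g y h :
  subdifferential f x g -> subdifferential f y h -> 0 <= '[g - h, x - y].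
Proof.
move=> xg yh.
have h1 := subdiff_ineq xg (esym (fineK (subdiff_fin yh))).
have h2 := subdiff_ineq yh (esym (fineK (subdiff_fin xg))).
move: h1 h2; move: (fine _) (fine _) => a b; abstract_inner; lra.
Qed.

Lemma epigraph_limit (x_ : nat -> X) (c_ : nat -> R) x (c : R) : closed_fun f ->
  x_ @ \oo --> x -> c_ @ \oo --> c -> (forall k, (f (x_ k) <= (c_ k)%:E)%E) ->
  (f x <= c%:E)%E.
Proof.
move=> fcl xx cc fle.
apply: (@closed_cvg _ _ \oo _ (fun k => (x_ k, c_ k : R^o)) _ fcl _ (x, c)).
  exact: nearW.
exact: (cvg_pair xx (cc : (c_ : nat -> R^o) @ \oo --> (c : R^o))).
Qed.

Lemma subdiff_limit (x_ g_ : nat -> X) x g : closed_fun f ->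
  x_ @ \oo --> x -> g_ @ \oo --> g ->
  (forall k, subdifferential f (x_ k) (g_ k)) -> subdifferential f x g.
Proof.
move=> fcl xx gg sub y.
case fy : (f y) (proj1 f_proper y) => [c||//] _; last by rewrite leey.
rewrite -leeBrDr// -EFinB.
apply: (@epigraph_limit _ (fun k => c - '[g_ k, y - x_ k]) _ _ fcl xx);
  last first.
  move=> k; rewrite -(fineK (subdiff_fin (sub k))) lee_fin lerBrDr.
  exact: subdiff_ineq (sub k) fy.
apply: cvgB; first exact: cvg_cst.
by apply: cvg_inner => //; apply: cvgB => //; exact: cvg_cst.
Qed.

End Subdifferential.

Lemma le_of_le_small (R : realType) (a b c : R) : 0 <= c ->
  (forall t, 0 < t < 1 -> a <= b + t * c) -> a <= b.
Proof.
move=> c0 h; rewrite leNgt; apply/negP => ba.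
have d0 : 0 < 2 * (c + 1 + (a - b)) by lra.
have := h ((a - b) / (2 * (c + 1 + (a - b)))).
rewrite ltr_pdivlMr// mul0r subr_gt0 ba ltr_pdivrMr// mul1r.
have -> : a - b < 2 * (c + 1 + (a - b)) by lra.
move=> /(_ isT); rewrite mulrAC -lerBlDl ler_pdivlMr//.
have : 0 < (a - b) * (a - b) by rewrite mulr_gt0 ?subr_gt0.
have : 0 <= (a - b) * c by rewrite mulr_ge0// subr_ge0 ltW.
nra.
Qed.

Section Prox.
Context {R : realType} {X : euclideanType R} (f : X -> \bar R).
Hypotheses (f_proper : proper_fun f) (f_closed : closed_fun f).
Hypothesis f_convex : econvex f.
Hypothesis f_sub : exists x g, subdifferential f x g.

(** The affine minorant given by one subgradient makes the objective of the
    proximal map coercive, so that a minimising sequence has a limit point;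
    the epigraph being closed, this limit point is a minimiser. *)
Lemma prox_attained (s : R) (z : X) : 0 < s ->
  exists y (v : R), f y = v%:E /\
    forall y' v', f y' = v'%:E ->
      v + s / 2 * `|z - y| ^+ 2 <= v' + s / 2 * `|z - y'| ^+ 2.
Proof.
move=> s0; have [x0 [g0 xg]] := f_sub.
have f0 := subdiff_fin f_proper xg; set v0 := fine (f x0).
(* Young's inequality takes half of the quadratic term to absorb the slope of
   the affine minorant. *)
pose B := v0 + '[g0, z - x0] - s^-1 * `|g0| ^+ 2.
have coercive y v : f y = v%:E ->
    B + s / 4 * `|y - z| ^+ 2 <= v + s / 2 * `|z - y| ^+ 2.
  move=> fy; have := subdiff_ineq f_proper xg fy; rewrite -/v0.
  rewrite (_ : y - x0 = (z - x0) + (y - z)); last by rewrite [RHS]addrC subrKA.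
  have := young (- g0) (y - z) (_ : 0 < 2 / s); rewrite divr_gt0// => /(_ isT).
  rewrite (distrC z) normrN innerNl (innerDr _ (z - x0)) /B invf_div.
  have -> : 2 / s * `|g0| ^+ 2 = 2 * (s^-1 * `|g0| ^+ 2) by rewrite mulrA.
  move: (v0) (inner g0 (z - x0)) (inner g0 (y - z)) (s^-1 * _)
    (Num.norm (y - z) ^+ 2).
  move=> *; lra.
pose S := [set r : R | exists y v, f y = v%:E /\ r = v + s / 2 * `|z - y| ^+ 2].
have S0 : S !=set0 by exists (v0 + s / 2 * `|z - x0| ^+ 2), x0, v0; rewrite fineK.
have SB : lbound S B.
  move=> r [y [v [fy ->]]]; apply: le_trans (coercive _ _ fy).
  by rewrite lerDl mulr_ge0 ?sqr_ge0// divr_ge0// ltW.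
have Sinf : has_inf S by split => //; exists B.
set m := inf S.
have /choice[y_ /choice[v_ yv]] (n : nat) :
    exists y v, f y = v%:E /\ v + s / 2 * `|z - y| ^+ 2 < m + n.+1%:R^-1.
  have n0 : 0 < n.+1%:R^-1 :> R by rewrite invr_gt0.
  have [_ [y [v [fy ->]]] rm] := inf_adherent n0 Sinf.
  by exists y, v.
have bnd k : `|y_ k - z| <= 1 + 4 / s * (m + 1 - B).
  have [fy lt] := yv k; have le := coercive _ _ fy.
  have k1 : k.+1%:R^-1 <= 1 :> R by rewrite invf_le1// ler1n.
  have /le_trans : `|y_ k - z| <= 1 + `|y_ k - z| ^+ 2.
    by have := sqr_ge0 (`|y_ k - z| - 1); rewrite sqrrB; nra.
  move=> h; apply: h; rewrite lerD2l.
  have h1 : s / 4 * `|y_ k - z| ^+ 2 <= m + 1 - B.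
    move: le lt k1; move: (Num.norm (z - y_ k) ^+ 2) (k.+1%:R^-1) => *; lra.
  have s4 : 0 <= 4 / s by rewrite divr_ge0// ltW.
  apply: le_trans (ler_wpM2l s4 h1); rewrite mulrA.
  by rewrite (_ : 4 / s * (s / 4) = 1) ?mul1r//; field; exact: lt0r_neq0.
have [h hk [l hl]] := bounded_euclidean_subseq bnd.
have yl : (y_ \o h) @ \oo --> l + z.
  rewrite (_ : y_ \o h = ((fun k => y_ k - z) \o h) \+ cst z); last first.
    by apply/funext => k /=; rewrite subrK.
  by apply: cvgD => //; exact: cvg_cst.
set y := l + z.
have fy : (f y <= (m - s / 2 * `|z - y| ^+ 2)%:E)%E.
  apply: (@epigraph_limit _ _ _ (y_ \o h)
    (fun k => m + (h k).+1%:R^-1 - s / 2 * `|z - y_ (h k)| ^+ 2)) => //.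
    apply: cvgB.
      rewrite -[m in X in _ --> X]addr0; apply: cvgD; first exact: cvg_cst.
      exact: (cvg_subseq hk (@cvg_harmonic R)).
    apply: cvgM; first exact: cvg_cst.
    rewrite normE2 (_ : (fun k => _) =
        fun k => '[z - (y_ \o h) k, z - (y_ \o h) k]); last first.
      by apply/funext => k; rewrite /= normE2.
    by apply: cvg_inner; apply: cvgB => //; exact: cvg_cst.
  by move=> k; have [-> lt] := yv (h k); rewrite lee_fin lerBrDr ltW.
case fyE : (f y) fy (proj1 f_proper y) => [v|//|//]; rewrite lee_fin => vm _.
exists y, v; split=> // y' v' fy'; rewrite -lerBrDr; apply: le_trans vm _.
rewrite lerD2r; apply: ge_inf; first by exists B.
by exists y', v'.
Qed.

(** First-order optimality at the minimiser, tested along segments. *)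
Lemma prox_subgradient (s : R) (z : X) : 0 < s ->
  exists y, subdifferential f y (s *: (z - y)).
Proof.
move=> s0; have [y [v [fy ymin]]] := prox_attained z s0.
exists y => y'; case fy' : (f y') (proj1 f_proper y') => [v'||//] _;
  last by rewrite leey.
rewrite fy -EFinD lee_fin.
apply: (@le_of_le_small _ _ _ (s / 2 * `|y' - y| ^+ 2)).
  by rewrite mulr_ge0 ?sqr_ge0// divr_ge0// ltW.
move=> t /[dup] t01 /andP[t0 t1].
have := f_convex y' y t01; rewrite fy fy' -!EFinM -EFinD.
set p := t *: y' + _.
case fp : (f p) (proj1 f_proper p) => [w|//|//] _; rewrite lee_fin => wle.
have pE : z - p = (z - y) - t *: (y' - y).
  rewrite /p scalerBl scale1r scalerBr opprD !opprB -[in RHS]addrA.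
  by congr (_ + _); rewrite [LHS]addrC [RHS]addrC; exact: addrAC.
have := ymin p w fp; rewrite pE (sqr_normB (z - y)) normrZ gtr0_norm// exprMn.
rewrite innerZl innerZr.
move: (Num.norm (z - y)) (Num.norm (y' - y)) (inner (z - y) (y' - y)) => a b c h.
by rewrite -(ler_pM2l t0); nra.
Qed.

End Prox.

(** Conversely a subgradient certifies the minimiser, and it is the only one
    since the quadratic term makes the objective strongly convex. *)
Lemma prox_unique (R : realType) (X : euclideanType R) (f : X -> \bar R)
    (c : R) (z y : X) : 0 < c -> f y \is a fin_num ->
  subdifferential f y (c^-1 *: (z - y)) -> prox (fun x => c%:E * f x)%E z = y.
Proof.
move=> c0 fyfin ysub; pose v := fine (f y).
have fy : f y = v%:E by rewrite fineK.
have strong y' v' : f y' = v'%:E ->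
    c * v + 2^-1 * `|z - y| ^+ 2 + 2^-1 * `|y' - y| ^+ 2
      <= c * v' + 2^-1 * `|z - y'| ^+ 2.
  move=> fy'; have := ysub y'; rewrite fy fy' -EFinD lee_fin innerZl.
  rewrite -(ler_pM2l c0) mulrDr mulrA mulfV ?gt_eqF// mul1r.
  rewrite (_ : z - y' = (z - y) - (y' - y)); last by rewrite opprB subrKA.
  rewrite (sqr_normB (z - y)).
  by move: (c * v) (c * v') (inner _ _) (Num.norm (z - y) ^+ 2)
           (Num.norm (y' - y) ^+ 2) => *; lra.
have f_val y' : (f y' = +oo)%E \/ exists v', f y' = v'%:E.
  have := ysub y'; rewrite fy -EFinD; case: (f y') => [v' _|_|//]; last by left.
  by right; exists v'.
have ymin : argmin (fun y0 => (c%:E * f y0 + (2^-1 * `|z - y0| ^+ 2)%:E)%E) y.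
  move=> y'; rewrite fy; have [->|[v' fy']] := f_val y'.
    by rewrite gt0_muley ?lte_fin// addye// leey.
  rewrite fy' -!EFinM -!EFinD lee_fin; apply: le_trans (strong _ _ fy').
  by rewrite lerDl mulr_ge0 ?sqr_ge0// invr_ge0.
rewrite /prox; case: xgetP => [p _ pmin|/(_ y)//].
have := pmin y; rewrite fy; have [->|[v' fp]] := f_val p.
  by rewrite gt0_muley ?lte_fin// addye.
rewrite fp -!EFinM -!EFinD lee_fin => le1.
have := le_trans (strong _ _ fp) le1.
rewrite gerDl pmulr_rle0 ?invr_gt0// => h.
by apply/eqP; rewrite -subr_eq0 -normr_eq0 -sqrf_eq0 eq_le h sqr_ge0.
Qed.

Section Conjugate.
Context {R : realType} {X : euclideanType R} (f : X -> \bar R).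
Hypothesis f_proper : proper_fun f.

(** Equality case of the Fenchel-Young inequality. *)
Lemma conjugate_subdiff x g : subdifferential f x g ->
  conjugate f g = ('[g, x] - fine (f x))%:E.
Proof.
move=> xg; have fx := subdiff_fin f_proper xg.
apply/eqP; rewrite eq_le; apply/andP; split; last first.
  by apply: ereal_sup_ubound; exists x => //; rewrite EFinB fineK.
apply: ge_ereal_sup => _ [y _ <-].
case fy : (f y) (proj1 f_proper y) => [c||//] _; last by rewrite /= leNye.
rewrite -EFinB lee_fin; have := subdiff_ineq f_proper xg fy.
rewrite innerBr; move: (fine _) (inner g y) (inner g x) => *; lra.
Qed.

Lemma conjugate_ge x g : ('[g, x]%:E - f x <= conjugate f g)%E.
Proof. by apply: ereal_sup_ubound; exists x. Qed.

Lemma subdiff_conjugate x g :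
  subdifferential f x g -> subdifferential (conjugate f) g x.
Proof.
move=> xg h; have fx := subdiff_fin f_proper xg.
apply: le_trans (conjugate_ge x h); rewrite (conjugate_subdiff xg).
rewrite -{2}(fineK fx) -EFinB -EFinD lee_fin innerBr (innerC h) (innerC g).
by move: (fine _) (inner x g) (inner x h) => *; lra.
Qed.

End Conjugate.

(** Moreau's decomposition: a proximal point [w] of [f] gives the proximal point
    [z - w / s] of the conjugate, with [w] as the point where it is a subgradient
    of [f]. *)
Lemma prox_conjugate (R : realType) (X : euclideanType R) (f : X -> \bar R)
    (s : R) (z : X) :
  proper_fun f -> closed_fun f -> econvex f ->
  (exists x g, subdifferential f x g) -> 0 < s ->
  let p := prox (fun v => s^-1%:E * conjugate f v)%E z in
  subdifferential f (s *: (z - p)) p.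
Proof.
move=> fp fc fv fs s0 /=; have si : 0 < s^-1 by rewrite invr_gt0.
have [w] := prox_subgradient fp fc fv fs (s *: z) si.
set p := s^-1 *: _ => wp.
have pE : s *: (z - p) = w.
  by rewrite scalerBr /p scalerA mulfV ?gt_eqF// scale1r subKr.
have -> : prox (fun v => s^-1%:E * conjugate f v)%E z = p; last by rewrite pE.
apply: prox_unique => //; first by rewrite (conjugate_subdiff fp wp).
by rewrite invrK pE; exact: subdiff_conjugate.
Qed.

Lemma prox_subdiff (R : realType) (X : euclideanType R) (f : X -> \bar R)
    (c : R) (z : X) :
  proper_fun f -> closed_fun f -> econvex f ->
  (exists x g, subdifferential f x g) -> 0 < c ->
  let p := prox (fun x => c%:E * f x)%E z in
  subdifferential f p (c^-1 *: (z - p)).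
Proof.
move=> fp fc fv fs c0 /=; have ci : 0 < c^-1 by rewrite invr_gt0.
have [y yz] := prox_subgradient fp fc fv fs z ci.
by rewrite (prox_unique c0 (subdiff_fin fp yz) yz).
Qed.

(** Prolonging the segment from [s] to [v] by half the radius beyond [v] leads to
    a point [v'] where the bound [M] applies; [v] is a convex combination of
    [v'] and [s] in which [v'] has a weight of the order of [|v - s|].  The
    subgradient at the centre bounds [f s] from below. *)
Lemma convex_lipschitz (R : realType) (U : euclideanType R) (f : U -> \bar R)
    (c g : U) : proper_fun f -> econvex f -> subdifferential f c g ->
  (exists rad M : R, 0 < rad /\ forall v, `|v - c| <= rad -> (f v <= M%:E)%E) ->
  exists rad C : R, [/\ 0 < rad, 0 <= C &
    forall v s t, `|v - c| <= rad -> `|s - c| <= rad -> f s = t%:E ->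
    exists2 fv, f v = fv%:E & fv <= t + C * `|v - s|].
Proof.
move=> fp fconv cg [rad [M [rad0 hM]]].
pose r := rad / 2; have r0 : 0 < r by rewrite divr_gt0.
pose m := fine (f c) - `|g| * r.
exists r, (`|M - m| / r); split=> //; first by rewrite divr_ge0// ltW.
move=> v s t vr sr fs.
have fin v' : `|v' - c| <= rad -> exists2 fv, f v' = fv%:E & fv <= M.
  move=> /hM; case: (f v') (proj1 fp v') => [fv||//] _; last by [].
  by rewrite lee_fin => ?; exists fv.
have rrad : r + r = rad by rewrite /r; lra.
have [fv fvE fvM] : exists2 fv, f v = fv%:E & fv <= M.
  by apply: fin; apply: le_trans vr _; rewrite -rrad lerDl ltW.
exists fv => //; have [vs|vs] := eqVneq v s.
  by move: fvE; rewrite vs fs subrr normr0 mulr0 addr0 => -[->].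
pose d := `|v - s|; have d0 : 0 < d by rewrite normr_gt0 subr_eq0.
pose v' := v + (r / d) *: (v - s).
have [fv' fv'E fv'M] : exists2 fv, f v' = fv%:E & fv <= M.
  apply: fin; rewrite /v' addrAC; apply: le_trans (ler_normD _ _) _.
  rewrite -rrad; apply: lerD => //.
  by rewrite normrZ gtr0_norm ?divr_gt0// -/d divfK ?gt_eqF.
have mt : m <= t.
  have := subdiff_ineq fp cg fs; apply: le_trans.
  rewrite /m lerD2l lerNl -innerNl; apply: le_trans (cauchy_schwarz _ _) _.
  by rewrite normrN; exact: ler_wpM2l.
have rd0 : 0 < r + d by rewrite addr_gt0.
pose k := d / (r + d).
have k01 : 0 < k < 1.
  by rewrite /k divr_gt0//= ltr_pdivrMr// mul1r ltrDr.
have vE : k *: v' + (1 - k) *: s = v.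
  rewrite /v' scalerDr scalerA (_ : k * (r / d) = 1 - k); last first.
    by rewrite /k; field; rewrite !lt0r_neq0.
  by rewrite -addrA -scalerDr subrK -scalerDl addrC subrK scale1r.
have := fconv k v' s k01; rewrite vE fvE fv'E fs -!EFinM -EFinD lee_fin => h.
apply: le_trans h _.
have k0 : 0 <= k by case/andP: k01 => /ltW.
apply: (@le_trans _ _ (t + k * `|M - m|)).
  have h1 : fv' - t <= `|M - m|.
    by apply: le_trans (ler_norm _); apply: lerB.
  have := ler_wpM2l k0 h1; rewrite mulrBr mulrBl mul1r.
  by move: (k * fv') (k * t) (k * _) => *; lra.
rewrite lerD2l mulrC -mulrA; apply: ler_wpM2l => //.
rewrite -/d mulrC /k; apply: ler_wpM2l; first exact: ltW.
by rewrite lef_pV2 ?posrE// lerDl ltW.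
Qed.

Lemma continuous_bounded_near (R : realType) (U : euclideanType R)
    (f : U -> \bar R) (c : U) : f c \is a fin_num -> {for c, continuous f} ->
  exists rad M : R, 0 < rad /\ forall v, `|v - c| <= rad -> (f v <= M%:E)%E.
Proof.
move=> fc cf; have lt : (f c < (fine (f c) + 1)%:E)%E.
  by rewrite -{1}(fineK fc) lte_fin ltrDl.
have : \forall v \near c, (f v < (fine (f c) + 1)%:E)%E.
  apply: (cf [set y | (y < (fine (f c) + 1)%:E)%E]); apply: open_nbhs_nbhs.
  by split; [exact: open_ereal_lt_ereal|].
move=> /nbhs_ballP[e /= e0 he].
exists (e / 2), (fine (f c) + 1); split; first by rewrite divr_gt0.
move=> v vc; apply/ltW/he; rewrite -ball_normE /= distrC.
by apply: le_lt_trans vc _; rewrite ltr_pdivrMr// mulr2n mulrDr mulr1 ltrDl.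
Qed.

(** At [us] both Fenchel-Young inequalities are equalities, so that the dual
    value is minus the primal one, which bounds the dual objective from
    below. *)
Lemma fenchel_dual_argmin (R : realType) (X U : euclideanType R)
    (G : X -> \bar R) (H : U -> \bar R) (K : {linear X -> U}) (Ks : U -> X)
    (xs : X) (us : U) : (forall x u, '[K x, u] = '[x, Ks u]) ->
  proper_fun G -> proper_fun H ->
  subdifferential G xs (- Ks us) -> subdifferential H (K xs) us ->
  argmin (fun u => conjugate G (- Ks u)%R + conjugate H u)%E us.
Proof.
move=> adj Gp Hp Gxs Hxs u.
have Gf := subdiff_fin Gp Gxs; have Hf := subdiff_fin Hp Hxs.
rewrite (conjugate_subdiff Gp Gxs) (conjugate_subdiff Hp Hxs) -EFinD.
apply: (@le_trans _ _ (('[- Ks u, xs]%:E - G xs) + ('[u, K xs]%:E - H (K xs)))%E).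
  rewrite -(fineK Gf) -(fineK Hf) -!EFinB -EFinD lee_fin !innerNl.
  by rewrite !(innerC _ (K xs)) !adj !(innerC _ xs); lra.
by apply: leeD; exact: conjugate_ge.
Qed.

(** The affine minorant of slope [g] and the quadratic upper bound are compared
    at [v + L^-1 *: (g - dh v)]. *)
Lemma subdiff_gradient (R : realType) (U : euclideanType R) (h : U -> R)
    (dh : U -> U) (L : R) (v g : U) : 0 < L ->
  (forall v s, h s <= h v + '[dh v, s - v] + L / 2 * `|s - v| ^+ 2) ->
  subdifferential (fun v => (h v)%:E) v g -> g = dh v.
Proof.
move=> L0 hd hg; pose s := v + L^-1 *: (g - dh v).
have := hg s; rewrite -EFinD lee_fin => /le_trans/(_ (hd v s)).
have -> : s - v = L^-1 *: (g - dh v) by rewrite /s addrAC subrr add0r.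
move=> h1.
rewrite normrZ exprMn real_normK ?num_real// !innerZr in h1.
have e1 : L / 2 * (L^-1 ^+ 2 * `|g - dh v| ^+ 2) = 2^-1 * (L^-1 * `|g - dh v| ^+ 2).
  by field; exact: lt0r_neq0.
have e2 : L^-1 * '[g, g - dh v] - L^-1 * '[dh v, g - dh v]
    = L^-1 * `|g - dh v| ^+ 2 by rewrite -mulrBr normE2 innerBl.
rewrite e1 in h1.
have : L^-1 * `|g - dh v| ^+ 2 <= 0.
  move: h1 e2; move: (h v) (L^-1 * inner (dh v) _) (L^-1 * inner g _).
  move: (L^-1 * _).
  by move=> *; lra.
rewrite pmulr_rle0 ?invr_gt0// => h2.
by apply/eqP; rewrite -subr_eq0 -normr_eq0 -sqrf_eq0 eq_le h2 sqr_ge0.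
Qed.

(** * Sequences, averages and Landau symbols *)

Section RealSequences.
Context {R : realType}.
Implicit Types (D : nat -> R) (C : R).

Lemma nonincreasing_rate D C : (forall n, D n.+1 <= D n) ->
  (forall n, \sum_(0 <= k < n) D k <= C) -> forall n, n.+1%:R * D n <= C.
Proof.
move=> Ddec DC n; apply: le_trans (DC n.+1).
have Dle m k : (m <= k)%N -> D k <= D m.
  by move=> /subnK <-; elim: (k - m)%N => // j ih; apply: le_trans (Ddec _) ih.
rewrite mulr_natl -[n.+1 in X in X <= _](subn0 n.+1) -sumr_const_nat.
by rewrite !big_nat; apply: ler_sum => k /andP[_ kn]; exact: Dle.
Qed.

(** Past a rank [N] where the tail of the series is below [e / 2], that tail
    dominates [(n + 1 - N) * D n], which is at least half of [(n + 1) * D n] as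
    soon as [2 * N <= n]. *)
Lemma nonincreasing_rate_o D C : (forall n, 0 <= D n) ->
  (forall n, D n.+1 <= D n) -> (forall n, \sum_(0 <= k < n) D k <= C) ->
  forall e, 0 < e -> \forall n \near \oo, n.+1%:R * D n <= e.
Proof.
move=> D0 Ddec DC e e0; pose S n := \sum_(0 <= k < n) D k.
have Dle m k : (m <= k)%N -> D k <= D m.
  by move=> /subnK <-; elim: (k - m)%N => // j ih; apply: le_trans (Ddec _) ih.
have hS : has_sup [set S n | n in setT].
  by split; [exists (S 0%N), 0%N|exists C => _ [n _ <-]; exact: DC].
have e2 : 0 < e / 2 by rewrite divr_gt0.
have [_ [N _ <-] SN] := sup_adherent e2 hS.
exists (2 * N)%N => // n /= Nn.
have NSn : (N <= n.+1)%N by lia.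
have : S n.+1 <= sup [set S n | n in setT].
  by apply: ub_le_sup; [case: hS|exists n.+1].
rewrite /S (big_cat_nat (n := N))//= -/(S N).
have : (n.+1 - N)%:R * D n <= \sum_(N <= k < n.+1) D k.
  rewrite mulr_natl -sumr_const_nat !big_nat.
  by apply: ler_sum => k /andP[_ kn]; exact: Dle.
have : n.+1%:R * D n <= 2 * ((n.+1 - N)%:R * D n).
  rewrite mulrA; apply: ler_wpM2r => //.
  by rewrite -natrM ler_nat; lia.
lra.
Qed.

Lemma sum_succ n :
  (\sum_(0 <= j < n) j.+1%:R)^-1 = 2 / (n * n.+1)%:R :> R.
Proof.
suff -> : \sum_(0 <= j < n) j.+1%:R = (n * n.+1)%:R / 2 :> R by rewrite invf_div.
elim: n => [|n ih]; first by rewrite big_nil mul0n mul0r.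
by rewrite big_nat_recr//= ih !natrM -!natr1; field.
Qed.

Lemma elittleo_near (f : nat -> \bar R) (r g : nat -> R) :
  (\forall k \near \oo, f k = (r k)%:E) ->
  (forall e, 0 < e -> \forall k \near \oo, `|r k| <= e * `|g k|) ->
  elittleo f g.
Proof.
move=> fr rg; split; first by apply: filterS fr => k ->.
apply/eqoP => e e0; move: (rg e e0); apply: filterS2 fr => k -> /=.
exact.
Qed.

Lemma ebigO_near (f : nat -> \bar R) (r g : nat -> R) (C : R) :
  (\forall k \near \oo, f k = (r k)%:E) ->
  (\forall k \near \oo, `|r k| <= C * `|g k|) -> ebigO f g.
Proof.
move=> fr rg; split; first by apply: filterS fr => k ->.
apply/eqO_exP; exists (`|C| + 1); first by rewrite ltr_wpDl.
move: rg; apply: filterS2 fr => k -> /= h; apply: le_trans h _.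
apply: ler_wpM2r => //; apply: le_trans (ler_norm _) _.
by rewrite lerDl.
Qed.

End RealSequences.

Lemma summation_by_parts (R : realType) (V : lmodType R) (y : nat -> V) m :
  \sum_(0 <= k < m) k.+1%:R *: (y k.+1 - y k) =
  m%:R *: y m - \sum_(0 <= k < m) y k.
Proof.
elim: m => [|m ih]; first by rewrite !big_nil scale0r subrr.
rewrite !big_nat_recr//= ih scalerBr [X in _ + (_ - X)](_ : _ = m%:R *: y m + y m).
  move: (m%:R *: y m) (m.+1%:R *: y m.+1) => s t.
  by rewrite !opprD [LHS]addrC !addrA (addrAC (t - s)) subrK addrAC.
by rewrite -natr1 scalerDl scale1r.
Qed.

Section Averages.
Context {R : realType} {X : euclideanType R}.

(** The ergodic mean of the theorem; [sum_succ] gives the usual form of the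
    normalisation. *)
Definition wavg (z : nat -> X) n : X :=
  (\sum_(0 <= j < n) j.+1%:R : R)^-1 *: \sum_(0 <= j < n) j.+1%:R *: z j.

Lemma wsum_gt0 n : 0 < \sum_(0 <= j < n.+1) j.+1%:R :> R.
Proof.
by rewrite big_nat_recr//= ltr_wpDl// sumr_ge0.
Qed.

Lemma wavg_linear (U : euclideanType R) (K : {linear X -> U}) (z : nat -> X) n :
  K (wavg z n) = (\sum_(0 <= j < n) j.+1%:R : R)^-1 *:
     \sum_(0 <= j < n) j.+1%:R *: K (z j).
Proof.
by rewrite linearZ linear_sum; congr (_ *: _); apply: eq_bigr => j _; rewrite linearZ.
Qed.

Lemma jensen (f : X -> \bar R) (z : nat -> X) (c : nat -> R) : econvex f ->
  (forall j, f (z j) = (c j)%:E) -> forall n,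
  (f (wavg z n.+1) <= ((\sum_(0 <= j < n.+1) j.+1%:R)^-1 *
                       \sum_(0 <= j < n.+1) j.+1%:R * c j)%:E)%E.
Proof.
move=> fv fz; elim=> [|n ih].
  by rewrite /wavg !big_nat1 invr1 !scale1r !mul1r fz.
rewrite /wavg [X in f (X^-1 *: _)]big_nat_recr//= [X in f (_ *: X)]big_nat_recr//=.
rewrite [X in (X^-1 * _)%:E]big_nat_recr//= [X in (_ * X)%:E]big_nat_recr//=.
have L0 := wsum_gt0 n; rewrite /wavg in ih; move: L0 ih.
set L := \sum_(0 <= j < n.+1) j.+1%:R; set Z := \sum_(0 <= j < n.+1) _ *: _.
set S := \sum_(0 <= j < n.+1) _ * _; set w : R := n.+2%:R => L0 ih.
have w0 : 0 < w by rewrite /w.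
clearbody w L.
pose t := L / (L + w); have Lw : 0 < L + w by rewrite addr_gt0.
have t01 : 0 < t < 1.
  by rewrite /t divr_gt0//= ltr_pdivrMr// mul1r ltrDl.
have Ln0 := lt0r_neq0 L0; have Lwn0 := lt0r_neq0 Lw.
have := fv t (L^-1 *: Z) (z n.+1) t01.
rewrite scalerA fz (_ : t / L = (L + w)^-1); last first.
  by rewrite /t; field; rewrite Ln0 Lwn0.
rewrite (_ : 1 - t = (L + w)^-1 * w); last by rewrite /t; field.
rewrite -scalerA -scalerDr => /le_trans; apply.
rewrite (_ : (_ * (S + _))%:E =
  (t%:E * (L^-1 * S)%:E + ((L + w)^-1 * w)%:E * (c n.+1)%:E)%E).
  by rewrite leeD2r// lee_wpmul2l// lee_fin; case/andP: t01 => /ltW.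
by rewrite -!EFinM -EFinD /t; congr (_%:E); field; rewrite Ln0 Lwn0.
Qed.

(** No weight exceeds [n.+1], hence the distance of the average to the limit is
    at most twice the Cesaro mean of the distances. *)
Lemma cvg_wavg (z : nat -> X) (l : X) : z @ \oo --> l ->
  (fun n => wavg z n.+1) @ \oo --> l.
Proof.
move=> zl; have a0 := cesaro (cvg_norm_sub zl).
apply: (@cvg_norm_le _ _ _ (fun n => 2 * arithmetic_mean (fun k => `|z k - l|) n)).
  move=> n; have L0 := wsum_gt0 n.
  rewrite (_ : wavg z n.+1 - l = wavg (fun j => z j - l) n.+1); last first.
    rewrite /wavg /=.
    rewrite [in RHS](eq_bigr (fun j => j.+1%:R *: z j - j.+1%:R *: l)); last first.
      by move=> j _; exact: scalerBr.
    rewrite sumrB scalerBr; congr (_ - _).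
    by rewrite -scaler_suml scalerA mulVf ?scale1r// gt_eqF.
  rewrite /wavg normrZ gtr0_norm ?invr_gt0// sum_succ.
  rewrite /arithmetic_mean /= /series /=.
  apply: (@le_trans _ _ (2 / (n.+1 * n.+2)%:R *
     (n.+1%:R * \sum_(0 <= k < n.+1) `|z k - l|))).
    apply: ler_wpM2l; first by rewrite divr_ge0.
    apply: le_trans (ler_norm_sum _ _ _) _; rewrite mulr_sumr !big_nat.
    apply: ler_sum => j /andP[_ jn]; rewrite normrZ normr_nat.
    by apply: ler_wpM2r => //; rewrite ler_nat.
  rewrite !mulrA; apply: ler_wpM2r; first exact: sumr_ge0.
  rewrite (_ : 2 / (n.+1 * n.+2)%:R * n.+1%:R = 2 / n.+2%:R :> R).
    by apply: ler_wpM2l => //; rewrite lef_pV2 ?posrE// ler_nat.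
  by rewrite natrM invfM mulrA mulrAC divfK// pnatr_eq0.
by rewrite -[0](mulr0 2); apply: cvgM => //; exact: cvg_cst.
Qed.

End Averages.

Lemma near_shift (P : nat -> Prop) :
  (\forall k \near \oo, P k.+1) -> \forall k \near \oo, P k.
Proof. by move=> [N _ NP]; exists N.+1 => // -[//|k] /= ?; exact: NP. Qed.

Lemma elittleo_sqrt (R : realType) (f : nat -> \bar R) (D : nat -> R) (c C : R) :
  (forall k, 0 <= D k) ->
  (\forall k \near \oo, exists2 v,
     f k.+1 = v%:E & 0 <= v - c <= C * Num.sqrt (D k)) ->
  (forall e, 0 < e -> \forall k \near \oo, k.+1%:R * D k <= e) ->
  elittleo (fun k => f k - c%:E)%E (fun k => (Num.sqrt k%:R)^-1).
Proof.
move=> D0 fD rate; apply: (@elittleo_near _ _ (fun k => fine (f k) - c)).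
  apply: near_shift; apply: filterS fD => k [v -> _].
  by rewrite -EFinB.
move=> e e0; pose d := e / (`|C| + 1).
have C1 : 0 < `|C| + 1 by rewrite ltr_wpDl.
have d0 : 0 < d by rewrite divr_gt0.
apply: near_shift.
apply: filterS2 fD (rate (d ^+ 2) (exprn_gt0 _ d0)) => k [v -> /andP[v0 vD]] kD.
have k0 : 0 < Num.sqrt k.+1%:R :> R by rewrite sqrtr_gt0.
rewrite /= ger0_norm// ger0_norm ?invr_ge0 ?(ltW k0)// ler_pdivlMr//.
have h : Num.sqrt (D k) * Num.sqrt k.+1%:R <= d.
  rewrite -sqrtrM// mulrC -(ger0_norm (ltW d0)) -sqrtr_sqr.
  exact: ler_wsqrtr.
apply: (@le_trans _ _ ((`|C| + 1) * d)); last first.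
  by rewrite /d mulrC divfK// gt_eqF.
apply: le_trans (ler_wpM2r (ltW k0) vD) _; rewrite -mulrA.
apply: (@le_trans _ _ (`|C| * (Num.sqrt (D k) * Num.sqrt k.+1%:R))).
  by apply: ler_wpM2r (ler_norm C); rewrite mulr_ge0 ?sqrtr_ge0.
by apply: ler_pM => //; rewrite ?mulr_ge0 ?sqrtr_ge0// lerDl.
Qed.

Lemma ebigO_inv (R : realType) (f : nat -> \bar R) (c C : R) :
  (\forall k \near \oo, exists2 v,
     f k.+1 = v%:E & 0 <= v - c <= C / k.+1%:R) ->
  ebigO (fun k => f k - c%:E)%E (fun k => k%:R^-1).
Proof.
move=> fD; apply: (@ebigO_near _ _ (fun k => fine (f k) - c) _ C).
  by apply: near_shift; apply: filterS fD => k [v -> _]; rewrite -EFinB.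
apply: near_shift; apply: filterS fD => k [v -> /andP[v0 vC]] /=.
by rewrite ger0_norm// ger0_norm ?invr_ge0.
Qed.

(** The gaps of the running minimum are nonincreasing, and summable since they
    are at most the gaps of the sequence. *)
Lemma running_min_rate (R : realType) (f : nat -> \bar R) (v : nat -> R)
    (c C : R) : (forall k, f k.+1 = (v k)%:E) -> (forall k, c <= v k) ->
  (forall n, \sum_(0 <= k < n) (v k - c) <= C) ->
  elittleo (fun k => (\big[Order.min/+oo]_(1 <= i < k.+1) f i - c%:E)%E)
           (fun k => k%:R^-1).
Proof.
move=> fv cv sumC.
pose m := fix m k : R := if k is k'.+1 then Num.min (m k') (v k) else v 0%N.
have mE k : (\big[Order.min/+oo]_(1 <= i < k.+2) f i)%E = (m k)%:E.
  elim: k => [|k ih]; first by rewrite big_nat1 fv.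
  by rewrite big_nat_recr//= ih fv /= EFin_min.
have mv k : m k <= v k by case: k => //= k; rewrite ge_min lexx orbT.
have cm k : c <= m k by elim: k => //= k ih; rewrite le_min ih cv.
have rate := @nonincreasing_rate_o _ (fun k => m k - c) C _ _ _.
apply: (@elittleo_near _ _ (fun k => m k.-1 - c)).
  by exists 1%N => // -[//|k] _; rewrite mE -EFinB.
move=> e e0; have [||n|N _ hN] := rate _ _ _ e e0.
- by move=> n; rewrite subr_ge0.
- by move=> n; rewrite lerD2r /= ge_min lexx.
- apply: le_trans (sumC n); apply: ler_sum => k _; by rewrite lerD2r.
exists N.+1 => // -[//|k] /= Nk.
rewrite !ger0_norm ?invr_ge0 ?subr_ge0// ler_pdivlMr// mulrC; exact: hN.
Qed.

(** * One iteration *)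

Lemma subrACA (V : zmodType) (x y z t : V) :
  (x - y) - (z - t) = (x - z) - (y - t).
Proof. by rewrite !opprD !opprK addrACA. Qed.

Section Iteration.
Context {R : realType} {X U : euclideanType R}.
(* [Ks] stands for the adjoint of [K], and [dF] for the gradient of [F]. *)
Variables (K : {linear X -> U}) (Ks : {linear U -> X}) (dF : X -> X).
Variables (Reg : X -> \bar R) (H : U -> \bar R) (L gamma eta : R).
Hypothesis adj : forall x u, '[K x, u] = '[x, Ks u].
Hypothesis Kle : forall x, `|K x| ^+ 2 <= eta * `|x| ^+ 2.
Hypothesis Ksle : forall u, `|Ks u| ^+ 2 <= eta * `|u| ^+ 2.
Hypotheses (L0 : 0 < L) (g0 : 0 < gamma) (eta0 : 0 < eta).
Hypothesis gL : gamma * L < 2.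
Hypothesis dF_coco : forall x y,
  L^-1 * `|dF x - dF y| ^+ 2 <= '[dF x - dF y, x - y].
Hypothesis dF_lip : forall x y, `|dF x - dF y| <= L * `|x - y|.
Hypotheses (Reg_proper : proper_fun Reg) (H_proper : proper_fun H).

(** [eta - K K*], which is nonnegative since [eta] is at least the squared norm
    of [K]. *)
Definition defect (u : U) : U := eta *: u - K (Ks u).

(** The squared seminorm for which the iteration is averaged.  It is the squared
    norm of the Davis-Yin state when [K] is completed into an operator whose
    composition with its adjoint is [eta].  It may vanish at some [(0, u)] with
    [u] nonzero when [eta] is the squared norm of [K]. *)
Definition energy (a : X) (u : U) : R := '[a, a] + '[defect u, u].

Lemma defect_inner u v : '[defect u, v] = eta * '[u, v] - '[Ks u, Ks v].
Proof. by rewrite innerBl innerZl adj. Qed.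

Lemma defectB u v : defect (u - v) = defect u - defect v.
Proof.
by rewrite /defect scalerBr (linearB Ks) (linearB K) subrACA.
Qed.

Lemma defect_ge0 u : 0 <= '[defect u, u].
Proof. by rewrite defect_inner -!normE2 subr_ge0. Qed.

Lemma energy_ge0 a u : 0 <= energy a u.
Proof. by rewrite addr_ge0 ?inner_ge0 ?defect_ge0. Qed.

Lemma sqr_norm_le_energy a u : `|a| ^+ 2 <= energy a u.
Proof. by rewrite normE2 lerDl defect_ge0. Qed.

Lemma defect_norm u : `|defect u| ^+ 2 <= eta * '[defect u, u].
Proof.
have := Kle (Ks u).
rewrite (defect_inner u u) (normE2 (defect u)) {2}/defect innerBr innerZr.
rewrite defect_inner (innerC _ (K _)) /defect innerBr innerZr !adj !normE2.
rewrite !adj; move: (inner u u) (inner (Ks u) (Ks u)) => a b; nra.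
Qed.

Lemma energy_sub a p u d : energy (a - p) (u - d) =
  energy a u - 2 * '[p, a] - 2 * '[defect d, u] + energy p d.
Proof.
rewrite /energy !defect_inner (linearB Ks) !innerE (innerC a p) (innerC u d).
by rewrite (innerC (Ks u) (Ks d)); ring.
Qed.

Lemma energyD_le p p' d d' :
  energy (p + p') (d + d') <= 2 * energy p d + 2 * energy p' d'.
Proof.
have h1 := energy_sub p (- p') d (- d'); rewrite !opprK in h1.
have h2 := energy_sub p p' d d'; have h3 := energy_ge0 (p - p') (d - d').
have h4 : energy (- p') (- d') = energy p' d'.
  by rewrite /energy !defect_inner linearN !innerE; ring.
have h5 : '[- p', p] = - '[p', p] by rewrite innerNl.
have h6 : '[defect (- d'), d] = - '[defect d', d].
  by rewrite !defect_inner linearN !innerE; ring.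
rewrite h1 h4 h5 h6; move: h3; rewrite h2.
move: (energy p d) (energy p' d') (inner p' p) (inner (defect d') d).
by move=> *; lra.
Qed.

Lemma energy_le_norm z v : energy z v <= `|z| ^+ 2 + eta * `|v| ^+ 2.
Proof.
rewrite /energy defect_inner -!normE2 lerD2l gerBl.
exact: sqr_ge0.
Qed.

(** The seminorm is chosen so that, in the change of energy over one step, all
    the inner products that involve [K] cancel. *)
Lemma energy_identity (a p x g r : X) (u d w : U) :
  a = gamma^-1 *: x - g - Ks u -> r = (a - p) - gamma^-1 *: x ->
  w = K x + gamma *: (K p - defect d) ->
  energy a u = energy (a - p) (u - d) - energy p d
    - 2 / gamma * ('[r, x] + '[w, u] + '[g, x]) - 2 * '[p, g].
Proof.
move=> aE rE wE; rewrite energy_sub.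
have -> : '[p, a] = gamma^-1 * '[p, x] - '[p, g] - '[p, Ks u].
  by rewrite aE !innerBr innerZr.
have -> : '[r, x] = - '[g, x] - '[x, Ks u] - '[p, x].
  by rewrite rE aE !innerBl (innerC (Ks u)); ring.
have -> : '[w, u] = '[x, Ks u] + gamma * '[p, Ks u] - gamma * '[defect d, u].
  by rewrite wE innerDl innerZl innerBl !adj; ring.
by field; exact: lt0r_neq0.
Qed.

(** An iteration seen through the optimality conditions of its two proximal
    steps, with [a = q - K* u]; [w] is the point where the new dual variable is
    a subgradient of [H]. *)
Definition pd3o_step (a : X) (u : U) (x : X) (w : U) (a' : X) (u' : U) : Prop :=
  [/\ subdifferential Reg x (a - gamma^-1 *: x), subdifferential H w u',
      a' = gamma^-1 *: x - dF x - Ks u' &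
      w = K x + gamma *: (K (a' - a) - defect (u' - u))].

Section TwoSteps.
Variables (a b x y a' b' : X) (u v w z u' v' : U).
Hypotheses (st1 : pd3o_step a u x w a' u') (st2 : pd3o_step b v y z b' v').

Let p := (a' - a) - (b' - b).
Let d := (u' - u) - (v' - v).
Let B := '[(a - gamma^-1 *: x) - (b - gamma^-1 *: y), x - y]
  + '[w - z, u' - v'] + '[dF x - dF y, x - y].

Lemma two_steps_identity : energy (a' - b') (u' - v') =
  energy (a - b) (u - v) - energy p d - 2 / gamma * B
    - 2 * '[p, dF x - dF y].
Proof.
have pE : (a' - b') - p = a - b by rewrite /p (subrACA a' a) subKr.
have dE : (u' - v') - d = u - v by rewrite /d (subrACA u' u) subKr.
have [_ _ aE wE] := st1; have [_ _ bE zE] := st2.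
rewrite (@energy_identity (a' - b') p (x - y) (dF x - dF y)
  ((a - gamma^-1 *: x) - (b - gamma^-1 *: y)) (u' - v') d (w - z)) ?pE ?dE//.
- rewrite aE bE (linearB Ks) scalerBr.
  by rewrite subrACA (subrACA (gamma^-1 *: x)).
- by rewrite scalerBr subrACA.
- rewrite wE zE (opprD (K y)) addrACA -(linearB K) -scalerBr.
  by congr (_ + _ *: _); rewrite subrACA -(linearB K) -defectB.
Qed.

Let B_monotone : '[dF x - dF y, x - y] <= B.
Proof.
have [xa wu _ _] := st1; have [yb zv _ _] := st2.
rewrite /B lerDr addr_ge0// ?(subdiff_monotone Reg_proper xa yb)//.
by rewrite innerC; exact: (subdiff_monotone H_proper wu zv).
Qed.

Let coco : `|dF x - dF y| ^+ 2 <= L * '[dF x - dF y, x - y].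
Proof. by rewrite -ler_pdivrMl// dF_coco. Qed.

(** The step size condition [gamma * L < 2] leaves room for absorbing the
    inner product with the gradient into the cocoercivity of the gradient and
    a fraction of the energy of the increment. *)
Lemma energy_contract : energy (a' - b') (u' - v')
    + (1 - gamma * L / 2) * energy p d <= energy (a - b) (u - v).
Proof.
have gLp : 0 < gamma * L by rewrite mulr_gt0.
have th0 : 0 < gamma * L / 2 by rewrite divr_gt0.
have := young (- p) (dF x - dF y) th0.
rewrite normrN innerNl invf_div => hy.
have hp := ler_wpM2l (ltW th0) (sqr_norm_le_energy p d).
have g2 : 0 <= 2 / gamma by rewrite divr_ge0// ltW.
have gl2 : 0 <= 2 / (gamma * L) by rewrite divr_ge0// ltW.
have hc : 2 / (gamma * L) * `|dF x - dF y| ^+ 2 <= 2 / gamma * B.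
  apply: le_trans (ler_wpM2l gl2 coco) _; rewrite mulrA.
  rewrite (_ : 2 / (gamma * L) * L = 2 / gamma); last first.
    by field; rewrite !lt0r_neq0.
  exact: ler_wpM2l.
rewrite two_steps_identity; move: hy hp hc.
move: (Num.norm p ^+ 2) (Num.norm (dF x - dF y) ^+ 2) => n1 n2.
move: (inner p _) (energy p d) (energy (a - b) _) (2 / gamma * B) => *; lra.
Qed.

(** As in [energy_contract], but keeping half of the monotone inner products
    rather than the energy of the increment. *)
Lemma monotonicity_le_energy : gamma^-1 * B <= energy (a - b) (u - v)
    - energy (a' - b') (u' - v') + gamma * L * energy p d.
Proof.
have gLp : 0 < gamma * L by rewrite mulr_gt0.
have := young (- p) (dF x - dF y) gLp.
rewrite normrN innerNl => hy.
have hp := ler_wpM2l (ltW gLp) (sqr_norm_le_energy p d).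
have gi : 0 <= gamma^-1 by rewrite invr_ge0 ltW.
have gli : 0 <= (gamma * L)^-1 by rewrite invr_ge0 ltW.
have hc : (gamma * L)^-1 * `|dF x - dF y| ^+ 2 <= gamma^-1 * B.
  apply: le_trans (ler_wpM2l gli coco) _; rewrite mulrA.
  rewrite (_ : (gamma * L)^-1 * L = gamma^-1); last first.
    by field; rewrite !lt0r_neq0.
  exact: ler_wpM2l.
have he := energy_ge0 p d.
rewrite two_steps_identity -(mulrA 2 gamma^-1).
move: hy hp hc he.
move: (Num.norm p ^+ 2) (Num.norm (dF x - dF y) ^+ 2) => n1 n2.
move: (inner p _) (energy p d) (energy (a - b) _) (gamma^-1 * B) => *; lra.
Qed.

(** Proximal maps are nonexpansive, and [x] is the proximal point at
    [gamma *: a]. *)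
Lemma primal_le_energy : `|x - y| ^+ 2 <= gamma ^+ 2 * energy (a - b) (u - v).
Proof.
have [xa _ _ _] := st1; have [yb _ _ _] := st2.
have := subdiff_monotone Reg_proper xa yb.
rewrite subrACA -scalerBr innerBl innerZl -normE2 subr_ge0.
rewrite ler_pdivrMl// => h.
apply: le_trans (ler_wpM2l (sqr_ge0 gamma) (sqr_norm_le_energy _ (u - v))).
have := young (gamma *: (a - b)) (x - y) ltr01.
rewrite innerZl normrZ exprMn real_normK ?num_real// invr1 !mul1r.
move: h; move: (inner _ _) (Num.norm (x - y) ^+ 2) (Num.norm (a - b) ^+ 2).
by move=> *; nra.
Qed.

(** The energy may fail to control [u - v], but it controls the next dual
    variables: in [w - z] their difference occurs with the coefficient
    [- gamma * eta], the rest being controlled by the energy, so that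
    monotonicity of the subdifferential of [H] bounds it. *)
Lemma dual_le_energy :
  `|u' - v'| ^+ 2 <= 40 / eta * energy (a - b) (u - v).
Proof.
case: (st1) (st2) => _ wu aE wE [_ zv bE zE].
set E := energy _ _; set du := u' - v'.
(* what remains of [w - z] once [- gamma * eta *: du] is taken away *)
pose s := 2 *: K (x - y) + (- gamma) *: K (dF x - dF y)
  + (- gamma) *: K (a - b) + gamma *: defect (u - v).
have sE : '[s, du] = '[w - z, du] + gamma * eta * '[du, du].
  rewrite wE zE aE bE /s /du /defect.
  rewrite !(linearB K) !(linearB Ks) !(linearB K) !(linearZ_LR K).
  by rewrite !innerE; field; exact: lt0r_neq0.
have := subdiff_monotone H_proper wu zv; rewrite innerC -/du => mon.
have ge0 : 0 < gamma * eta by rewrite mulr_gt0.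
have h1 : (gamma * eta) ^+ 2 * `|du| ^+ 2 <= `|s| ^+ 2.
  have := young s (gamma * eta *: du) ltr01; rewrite innerZr invr1 !mul1r sE.
  rewrite normrZ exprMn real_normK ?num_real// -normE2.
  have := mulr_ge0 (ltW ge0) mon.
  move: (gamma * eta) (Num.norm du ^+ 2) (Num.norm s ^+ 2) (inner (w - z) du).
  by move=> *; nra.
have hE := energy_ge0 (a - b) (u - v); rewrite -/E in hE.
have g2 := sqr_ge0 gamma.
have ge : 0 <= gamma ^+ 2 * eta by rewrite mulr_ge0// ltW.
have hx : eta * `|x - y| ^+ 2 <= gamma ^+ 2 * eta * E.
  by rewrite (mulrC (gamma ^+ 2)) -mulrA; apply: ler_wpM2l primal_le_energy; exact: ltW.
have k1 : `|2 *: K (x - y)| ^+ 2 <= 4 * (gamma ^+ 2 * eta * E).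
  rewrite normrZ exprMn normr_nat -natrX; apply: ler_wpM2l => //.
  exact: le_trans (Kle _) hx.
have k2 : `|(- gamma) *: K (dF x - dF y)| ^+ 2 <= 4 * (gamma ^+ 2 * eta * E).
  rewrite normrZ exprMn real_normK ?num_real// sqrrN.
  have hg : `|dF x - dF y| ^+ 2 <= L ^+ 2 * `|x - y| ^+ 2.
    by rewrite -exprMn lerXn2r// ?nnegrE ?mulr_ge0// ltW.
  apply: le_trans (ler_wpM2l g2 (le_trans (Kle _) (ler_wpM2l (ltW eta0) hg))) _.
  rewrite (_ : gamma ^+ 2 * (eta * (L ^+ 2 * `|x - y| ^+ 2)) =
      (gamma * L) ^+ 2 * (eta * `|x - y| ^+ 2)); last by ring.
  apply: (@le_trans _ _ ((gamma * L) ^+ 2 * (gamma ^+ 2 * eta * E))).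
    by apply: ler_wpM2l hx; exact: sqr_ge0.
  apply: ler_wpM2r; first exact: mulr_ge0.
  have gLp : 0 < gamma * L by rewrite mulr_gt0.
  by move: (gamma * L) gL gLp => t; nra.
have k3 : `|(- gamma) *: K (a - b)| ^+ 2 <= gamma ^+ 2 * eta * E.
  rewrite normrZ exprMn real_normK ?num_real// sqrrN -mulrA.
  apply: ler_wpM2l => //; apply: le_trans (Kle _) _.
  apply: ler_wpM2l; [exact: ltW|exact: sqr_norm_le_energy].
have k4 : `|gamma *: defect (u - v)| ^+ 2 <= gamma ^+ 2 * eta * E.
  rewrite normrZ exprMn real_normK ?num_real// -mulrA.
  apply: ler_wpM2l => //; apply: le_trans (defect_norm _) _.
  by apply: ler_wpM2l; [exact: ltW|rewrite lerDr inner_ge0].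
have : (gamma * eta) ^+ 2 * `|du| ^+ 2 <= 40 * (gamma ^+ 2 * eta * E).
  apply: le_trans h1 (le_trans (sqr_norm4 _ _ _ _) _).
  move: k1 k2 k3 k4; move: (gamma ^+ 2 * eta * E) => t.
  move: (Num.norm (2 *: _) ^+ 2) (Num.norm (- gamma *: K (dF x - dF y)) ^+ 2).
  move: (Num.norm (- gamma *: K (a - b)) ^+ 2) (Num.norm (gamma *: _) ^+ 2).
  by move=> *; lra.
rewrite (_ : 40 * _ = (gamma * eta) ^+ 2 * (40 / eta * E)).
  by rewrite ler_pM2l// exprn_gt0.
by field; exact: lt0r_neq0.
Qed.

(** Here the second step is at rest, so that the conditions at [y] add up to
    zero. *)
Lemma coupling_identity : b' = b -> v' = v -> z = K y ->
  '[a - a', x - y] = B - '[w - K x, u' - v'].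
Proof.
move=> bb vv zy; have [_ _ aE _] := st1; have [_ _ bE _] := st2.
rewrite /B zy {1}aE -{1}bb {1}bE !innerE !adj.
rewrite !(innerC (Ks _)).
ring.
Qed.

Lemma dual_pairing_le : '[w - z, u' - v'] <= B.
Proof.
have [xa wu _ _] := st1; have [yb zv _ _] := st2.
have gm : 0 <= '[dF x - dF y, x - y].
  by apply: le_trans (dF_coco _ _); rewrite mulr_ge0 ?sqr_ge0// invr_ge0 ltW.
by rewrite /B addrAC lerDr addr_ge0// (subdiff_monotone Reg_proper xa yb).
Qed.

End TwoSteps.

Lemma coupled_norm_le (p : X) (d : U) :
  `|K p - defect d| ^+ 2 <= 2 * eta * energy p d.
Proof.
have h1 := Kle p; have h2 := defect_norm d.
have := young (- K p) (defect d) ltr01.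
rewrite invr1 !mul1r normrN innerNl (sqr_normB (K p)) /energy -(normE2 p).
rewrite -mulrA mulrDr; move: h1 h2.
move: (Num.norm (K p) ^+ 2) (Num.norm (defect d) ^+ 2) (inner (K p) _).
by move: (eta * Num.norm p ^+ 2) (eta * inner _ _) => *; lra.
Qed.

Lemma residual_le (a a' x : X) (u u' w : U) : pd3o_step a u x w a' u' ->
  `|w - K x| ^+ 2 <= 2 * gamma ^+ 2 * eta * energy (a' - a) (u' - u).
Proof.
move=> [_ _ _ ->]; rewrite addrC addKr normrZ exprMn real_normK ?num_real//.
set p := a' - a; set d := u' - u.
rewrite (_ : 2 * gamma ^+ 2 * eta * energy p d =
  gamma ^+ 2 * (2 * eta * energy p d)); last by ring.
by apply: ler_wpM2l; [exact: sqr_ge0|exact: coupled_norm_le].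
Qed.

Section ValueGap.
Variables (F : X -> R) (xs : X) (Rs Hs : R).
Hypothesis F_lower : forall x y,
  F x + '[dF x, y - x] + (2 * L)^-1 * `|dF y - dF x| ^+ 2 <= F y.
Hypotheses (RsE : Reg xs = Rs%:E) (HsE : H (K xs) = Hs%:E).
Variables (a a' x : X) (u u' w : U).
Hypothesis st : pd3o_step a u x w a' u'.

(** The sum of the three subgradient inequalities at [xs], the one for [F] being
    strengthened by smoothness.  The value of [H] is taken at [w] because that is
    where the subgradient [u'] is available. *)
Lemma value_gap : F x + fine (Reg x) + fine (H w) - (F xs + Rs + Hs) <=
  '[a - a', x - xs] + '[u', w - K x] - (2 * L)^-1 * `|dF x - dF xs| ^+ 2.
Proof.
have [xa wu aE _] := st.
have h1 := subdiff_ineq Reg_proper xa RsE.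
have h2 := subdiff_ineq H_proper wu HsE.
have h3 := F_lower x xs; rewrite (distrC (dF xs)) in h3.
have -> : '[a - a', x - xs] =
    '[a - gamma^-1 *: x, x - xs] + '[dF x, x - xs] + '[u', K x - K xs].
  rewrite {1}aE !innerE !(innerC u') !adj !(innerC (Ks _)); ring.
move: h1 h2 h3.
rewrite -(opprB x xs) -(opprB w (K xs)) !innerNr (innerBr _ w) (innerBr u' w).
rewrite (innerBr u' (K x)); move: (fine _) (fine _) (F x) (F xs).
move: ((2 * L)^-1 * _) (inner _ (x - xs)) (inner (dF x) _).
by move: (inner u' w) (inner u' (K x)) (inner u' (K xs)) => *; lra.
Qed.

(** The inner products of [value_gap] are the change of the energy relative to
    the state [(a0, 0)], up to the inner product of the increment with the
    gradients, for which the squared norm of the gradients pays. *)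
Lemma value_gap_telescope (a0 := gamma^-1 *: xs - dF xs) :
  F x + fine (Reg x) + fine (H w) - (F xs + Rs + Hs) <=
  gamma / 2 * (energy (a - a0) u - energy (a' - a0) u')
    + gamma ^+ 2 * L / 2 * energy (a' - a) (u' - u).
Proof.
apply: le_trans value_gap _; have [_ _ aE wE] := st.
set p := a' - a; set d := u' - u; set g := dF x - dF xs.
have -> : energy (a - a0) u = energy (a' - a0) u' - 2 * '[p, a' - a0]
    - 2 * '[defect d, u'] + energy p d.
  have e1 : a - a0 = (a' - a0) - p by rewrite /p addrAC subKr.
  have e2 : u = u' - d by rewrite subKr.
  by rewrite -energy_sub -e1 -e2.
have -> : '[a - a', x - xs] = - gamma * '[p, a' - a0] - gamma * '[p, g]
    - gamma * '[p, Ks u'].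
  rewrite -(opprB a' a) -/p innerNl /a0 aE /g !innerBr !innerZr.
  by field; exact: lt0r_neq0.
have -> : '[u', w - K x] = gamma * '[p, Ks u'] - gamma * '[defect d, u'].
  rewrite wE addrC addKr innerZr innerC innerBl adj; ring.
have := young (gamma *: (- p)) g L0.
rewrite innerZl innerNl normrZ exprMn real_normK ?num_real// normrN => hy.
have hp : gamma ^+ 2 * L / 2 * `|p| ^+ 2 <= gamma ^+ 2 * L / 2 * energy p d.
  apply: ler_wpM2l (sqr_norm_le_energy _ _).
  by rewrite divr_ge0// mulr_ge0 ?sqr_ge0// ltW.
have he := mulr_ge0 (ltW g0) (energy_ge0 p d).
have -> : (2 * L)^-1 * `|g| ^+ 2 = 2^-1 * (L^-1 * `|g| ^+ 2).
  by rewrite invfM mulrA.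
have e1 : L * (gamma ^+ 2 * `|p| ^+ 2) = 2 * (gamma ^+ 2 * L / 2 * `|p| ^+ 2).
  by field.
rewrite e1 in hy.
move: hy hp he; move: (gamma ^+ 2 * L / 2 * Num.norm p ^+ 2) (L^-1 * _).
move: (gamma ^+ 2 * L / 2 * energy p d) (energy p d) (energy (a' - a0) u').
by move: (inner p g) (inner p (a' - a0)) (inner (defect d) u') => *; nra.
Qed.

End ValueGap.

(** * Convergence of the iterates *)

Section Trajectory.
Hypotheses (Reg_closed : closed_fun Reg) (H_closed : closed_fun H).
Variables (a : nat -> X) (u : nat -> U) (x : nat -> X) (w : nat -> U).
Hypothesis steps : forall k, pd3o_step (a k) (u k) (x k) (w k) (a k.+1) (u k.+1).

Definition increment k := energy (a k.+1 - a k) (u k.+1 - u k).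

Lemma increment_ge0 k : 0 <= increment k.
Proof. exact: energy_ge0. Qed.

Let contract_coef : 0 < 1 - gamma * L / 2.
Proof. by rewrite subr_gt0 ltr_pdivrMr// mul1r. Qed.

(** The step from [k.+1] is the step from [k] applied to a shifted state. *)
Lemma increment_dec k : increment k.+1 <= increment k.
Proof.
apply: le_trans (energy_contract (steps k.+1) (steps k)).
by rewrite lerDl mulr_ge0 ?energy_ge0// ltW.
Qed.

Definition at_rest (a0 : X) (u0 : U) (x0 : X) := pd3o_step a0 u0 x0 (K x0) a0 u0.

Section Distance.
Variables (as_ : X) (us : U) (xs : X).
Hypothesis rest : at_rest as_ us xs.
Let V k := energy (a k - as_) (u k - us).

Lemma distance_step k : V k.+1 + (1 - gamma * L / 2) * increment k <= V k.
Proof.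
apply: le_trans (energy_contract (steps k) rest).
by rewrite !subrr !subr0.
Qed.

Lemma distance_dec m k : (m <= k)%N -> V k <= V m.
Proof.
move=> /subnK <-; elim: (k - m)%N => // j; apply: le_trans.
apply: le_trans (distance_step (j + m)); rewrite lerDl mulr_ge0 ?increment_ge0//.
exact: ltW.
Qed.

Lemma increment_sum n :
  \sum_(0 <= k < n) increment k <= V 0%N / (1 - gamma * L / 2).
Proof.
rewrite ler_pdivlMr//; apply: (@le_trans _ _ (V 0%N - V n)); last first.
  by rewrite gerBl energy_ge0.
elim: n => [|n ih]; first by rewrite big_nil mul0r subrr.
rewrite big_nat_recr//= mulrDl; have := distance_step n.
move: ih; rewrite (mulrC (increment n)).
set S := \sum_(0 <= k < n) _.
by move: (S * _) (_ * increment n) (V 0%N) (V n) (V n.+1) => *; lra.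
Qed.

Lemma primal_distance k : `|x k - xs| ^+ 2 <= gamma ^+ 2 * V k.
Proof. exact: primal_le_energy (steps k) rest. Qed.

Lemma dual_distance k : `|u k.+1 - us| ^+ 2 <= 40 / eta * V k.
Proof. exact: dual_le_energy (steps k) rest. Qed.

End Distance.

Lemma cvg_dF (x_ : nat -> X) (l : X) : x_ @ \oo --> l ->
  (fun k => dF (x_ k)) @ \oo --> dF l.
Proof.
move=> xl; apply: (@cvg_norm_le _ _ _ (fun k => L * `|x_ k - l|)).
  by move=> k; exact: dF_lip.
rewrite -[0](mulr0 L); apply: cvgM; first exact: cvg_cst.
exact: cvg_norm_sub.
Qed.

Section Limit.
Variables (as0 : X) (us0 : U) (xs0 : X).
Hypothesis rest0 : at_rest as0 us0 xs0.

Lemma increment_cvg0 : increment @ \oo --> (0 : R).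
Proof.
have rate := nonincreasing_rate increment_dec (increment_sum rest0).
set C := _ / _ in rate.
have C0 : (fun k => C * harmonic k) @ \oo --> (0 : R).
  rewrite -[0](mulr0 C); apply: cvgM; first exact: cvg_cst.
  exact: cvg_harmonic.
apply: (squeeze_cvgr _ (cvg_cst 0) C0); apply: nearW => k.
rewrite increment_ge0 /= /harmonic /=.
by rewrite ler_pdivlMr// mulrC.
Qed.

Lemma residual_cvg0 : (fun k => w k - K (x k)) @ \oo --> (0 : U).
Proof.
apply: (cvg_sqr_norm (C := 2 * gamma ^+ 2 * eta) (v := increment)) increment_cvg0.
by move=> k; rewrite subr0; exact: residual_le (steps k).
Qed.

(** A limit point of the bounded sequence of iterates is a state at rest, the
    subdifferentials having closed graphs and the increments vanishing.  The
    distance to that state being nonincreasing, it tends to zero along the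
    whole sequence. *)
Lemma iterates_cvg : exists as_ us xs, [/\ at_rest as_ us xs,
  x @ \oo --> xs & u @ \oo --> us].
Proof.
have V0 k := distance_dec rest0 (leq0n k).
set v0 := energy (a 0%N - as0) (u 0%N - us0) in V0.
have xb k : `|x k| <= `|xs0| + (1 + gamma ^+ 2 * v0).
  apply: norm_le_sqr; apply: le_trans (primal_distance rest0 k) _.
  by apply: ler_wpM2l (V0 k); exact: sqr_ge0.
have ub k : `|u k.+1| <= `|us0| + (1 + 40 / eta * v0).
  apply: norm_le_sqr; apply: le_trans (dual_distance rest0 k) _.
  by apply: ler_wpM2l (V0 k); rewrite divr_ge0// ltW.
have [f fk [xs xl]] := bounded_euclidean_subseq xb.
have [h hk [us ul]] := bounded_euclidean_subseq (fun k => ub (f k)).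
pose e := f \o h; have ek k : (k <= e k)%N by apply: leq_trans (hk k) (fk _).
have xel : (x \o e) @ \oo --> xs by exact: (cvg_subseq hk xl).
have uel : (fun k => u (e k).+1) @ \oo --> us by [].
pose as_ := gamma^-1 *: xs - dF xs - Ks us.
have ael1 : (fun k => a (e k).+1) @ \oo --> as_.
  rewrite (_ : (fun k => _) = fun k =>
      gamma^-1 *: (x \o e) k - dF ((x \o e) k) - Ks (u (e k).+1)); last first.
    by apply/funext => k; have [_ _ -> _] := steps (e k).
  apply: cvgB; last exact: cvg_linear.
  apply: cvgB; last exact: cvg_dF.
  by apply: cvgZ => //; exact: cvg_cst.
have da0 : (fun k => a (e k).+1 - a (e k)) @ \oo --> (0 : X).
  apply: (cvg_sqr_norm (C := 1) (v := increment \o e)).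
    by move=> k; rewrite subr0 mul1r; exact: sqr_norm_le_energy.
  exact: (cvg_subseq ek increment_cvg0).
have ael : (a \o e) @ \oo --> as_.
  rewrite (_ : a \o e = fun k => a (e k).+1 - (a (e k).+1 - a (e k))); last first.
    by apply/funext => k /=; rewrite subKr.
  by rewrite -[as_]subr0; exact: cvgB.
have wel : (w \o e) @ \oo --> K xs.
  rewrite (_ : w \o e = fun k =>
      ((fun j => w j - K (x j)) \o e) k + K ((x \o e) k)); last first.
    by apply/funext => k /=; rewrite subrK.
  rewrite -[K xs]add0r; apply: cvgD; last exact: cvg_linear.
  exact: (cvg_subseq ek residual_cvg0).
have rest : at_rest as_ us xs.
  split; last by rewrite !subrr /defect (linear0 Ks) (linear0 K) !(scaler0, subr0) addr0.
  - apply: (subdiff_limit Reg_proper Reg_closed xel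
      (g_ := fun k => a (e k) - gamma^-1 *: x (e k))).
      by apply: cvgB => //; apply: cvgZ => //; exact: cvg_cst.
    by move=> k; have [] := steps (e k).
  - apply: (subdiff_limit H_proper H_closed wel uel).
    by move=> k; have [] := steps (e k).
  - by [].
pose V k := energy (a k - as_) (u k - us).
have Ve : (fun k => V (e k).+1) @ \oo --> (0 : R).
  have h0 : (fun k => `|a (e k).+1 - as_| ^+ 2 + eta * `|u (e k).+1 - us| ^+ 2)
      @ \oo --> (0 : R).
    rewrite -[0](_ : 0 * 0 + eta * (0 * 0) = 0); last by ring.
    have ha := cvg_norm_sub ael1; have hu := cvg_norm_sub uel.
    apply: cvgD; first exact: cvgM.
    by apply: cvgM; [exact: cvg_cst|exact: cvgM].
  apply: (squeeze_cvgr _ (cvg_cst 0) h0); apply: nearW => k.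
  by rewrite energy_ge0 energy_le_norm.
have Vl : V @ \oo --> (0 : R).
  apply/cvgrPdist_le => r r0; move/cvgrPdist_le : Ve => /(_ _ r0)[N _ VN].
  exists (e N).+1 => // k /= Nk.
  have := VN N (leqnn N); rewrite /= !sub0r !normrN !ger0_norm ?energy_ge0//.
  by apply: le_trans; exact: (distance_dec rest Nk).
exists as_, us, xs; split=> //.
  exact: (cvg_sqr_norm (primal_distance rest) Vl).
rewrite -(cvg_shiftS u); exact: (cvg_sqr_norm (dual_distance rest) Vl).
Qed.

End Limit.

(** * Convergence rates *)

Section Rates.
Variable F : X -> R.
Hypothesis F_lower : forall x y,
  F x + '[dF x, y - x] + (2 * L)^-1 * `|dF y - dF x| ^+ 2 <= F y.
Hypothesis F_convex : econvex (EFin \o F).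
Hypotheses (Reg_convex : econvex Reg) (H_convex : econvex H).
Variables (as_ : X) (us : U) (xs : X).
Hypothesis rest : at_rest as_ us xs.
Hypotheses (xl : x @ \oo --> xs) (ul : u @ \oo --> us).

Let Psi := primal_objective F Reg H K.
Let V k := energy (a k - as_) (u k - us).
Let Rs := fine (Reg xs).
Let Hs := fine (H (K xs)).
Let Psis := F xs + Rs + Hs.

Let RsE : Reg xs = Rs%:E.
Proof. by have [h _ _ _] := rest; rewrite fineK// (subdiff_fin Reg_proper h). Qed.

Let HsE : H (K xs) = Hs%:E.
Proof. by have [_ h _ _] := rest; rewrite fineK// (subdiff_fin H_proper h). Qed.

Let RkE k : Reg (x k) = (fine (Reg (x k)))%:E.
Proof. by have [h _ _ _] := steps k; rewrite fineK// (subdiff_fin Reg_proper h). Qed.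

Let HkE k : H (w k) = (fine (H (w k)))%:E.
Proof. by have [_ h _ _] := steps k; rewrite fineK// (subdiff_fin H_proper h). Qed.

Lemma objective_at_rest : Psi xs = Psis%:E.
Proof. by rewrite /Psi /primal_objective RsE HsE -!EFinD. Qed.

Lemma at_rest_argmin : argmin Psi xs.
Proof.
move=> y; rewrite objective_at_rest /Psi /primal_objective.
have [xa wu aE _] := rest.
case Ry : (Reg y) (proj1 Reg_proper y) => [r||//] _; last first.
  by case: (H (K y)) (proj1 H_proper (K y)) => [?||]; rewrite ?leey.
case Hy : (H (K y)) (proj1 H_proper (K y)) => [t||//] _; last by rewrite leey.
rewrite -!EFinD lee_fin.
have h1 := subdiff_ineq Reg_proper xa Ry.
have h2 := subdiff_ineq H_proper wu Hy.
have h3 := F_lower xs y.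
have h4 : 0 <= (2 * L)^-1 * `|dF y - dF xs| ^+ 2.
  by rewrite mulr_ge0 ?sqr_ge0// invr_ge0 ltW// mulr_gt0.
have h5 : '[as_ - gamma^-1 *: xs, y - xs] + '[dF xs, y - xs]
    + '[us, K y - K xs] = 0.
  by rewrite -(linearB K) (innerC us) adj (innerC _ (Ks us)) aE !innerE; ring.
move: h1 h2 h3 h4 h5; rewrite -/Rs -/Hs /Psis.
move: (inner _ _) (inner us _) (inner (dF xs) _) ((2 * L)^-1 * _).
by move=> *; lra.
Qed.

(** The gap of the objective when [H] is evaluated at [w k]. *)
Definition split_gap k := F (x k) + fine (Reg (x k)) + fine (H (w k)) - Psis.

Let D_rate : exists2 C : R, 0 <= C & forall k, k.+1%:R * increment k <= C.
Proof.
exists (V 0%N / (1 - gamma * L / 2)); last first.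
  by move=> k; exact: nonincreasing_rate increment_dec (increment_sum rest) k.
by rewrite divr_ge0 ?energy_ge0// ltW.
Qed.

(* How [H] is transported from [w k] to [K (x k)]; see [convex_lipschitz]. *)
Hypothesis H_near : exists rad C : R, [/\ 0 < rad, 0 <= C &
  forall v s t, `|v - K xs| <= rad -> `|s - K xs| <= rad -> H s = t%:E ->
  exists2 hv, H v = hv%:E & hv <= t + C * `|v - s|].

Let cvg_near (Z : euclideanType R) (z : nat -> Z) (l : Z) (r : R) : 0 < r ->
  z @ \oo --> l -> \forall k \near \oo, `|z k - l| <= r.
Proof.
move=> r0 /cvgrPdist_le /(_ r r0); apply: filterS => k; by rewrite distrC.
Qed.

Let wl : w @ \oo --> K xs.
Proof.
rewrite (_ : w = fun k => (w k - K (x k)) + K (x k)); last first.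
  by apply/funext => k; rewrite subrK.
rewrite -[K xs]add0r; apply: cvgD; last exact: cvg_linear.
exact: residual_cvg0 rest.
Qed.

(** Each inner product of [value_gap] has one bounded factor, the other one being
    bounded by the norm of the increment. *)
Lemma last_iterate_rate : exists C, \forall k \near \oo, exists2 v,
  Psi (x k) = v%:E & 0 <= v - Psis <= C * Num.sqrt (increment k).
Proof.
have [rad [C [rad0 C0 Hle]]] := H_near.
set G := 2 * gamma ^+ 2 * eta.
have G0 : 0 <= G by rewrite /G !mulr_ge0 ?sqr_ge0// ltW.
exists (1 + (`|us| + 1) * Num.sqrt G + C * Num.sqrt G).
near=> k.
have k1 : `|K (x k) - K xs| <= rad.
  by near: k; apply: cvg_near rad0 _; exact: cvg_linear.
have k2 : `|w k - K xs| <= rad by near: k; exact: cvg_near rad0 wl.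
have k3 : `|x k - xs| <= 1 by near: k; exact: cvg_near ltr01 xl.
have k4 : `|u k.+1 - us| <= 1.
  by near: k; apply: cvg_near ltr01 _; rewrite (cvg_shiftS u).
have [hv hvE hvle] := Hle _ _ _ k1 k2 (HkE k).
have PE : Psi (x k) = (F (x k) + fine (Reg (x k)) + hv)%:E.
  by rewrite /Psi /primal_objective hvE RkE -!EFinD.
exists (F (x k) + fine (Reg (x k)) + hv) => //.
have := at_rest_argmin (x k); rewrite objective_at_rest PE lee_fin => lower.
rewrite subr_ge0 lower /=.
have gap := value_gap F_lower RsE HsE (steps k); rewrite -/Psis in gap.
set s := Num.sqrt (increment k).
have s0 : 0 <= s by exact: sqrtr_ge0.
have n1 : `|a k - a k.+1| <= s.
  rewrite distrC -ler_sqr ?nnegrE// sqr_sqrtr ?increment_ge0//.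
  exact: sqr_norm_le_energy.
have n2 : `|w k - K (x k)| <= Num.sqrt G * s.
  rewrite -sqrtrM// -ler_sqr ?nnegrE ?sqrtr_ge0// sqr_sqrtr.
    exact: residual_le (steps k).
  by rewrite mulr_ge0 ?increment_ge0.
have n3 : `|u k.+1| <= `|us| + 1.
  by rewrite -(subrK us (u k.+1)) addrC (le_trans (ler_normD _ _))// lerD2l.
have c1 : '[a k - a k.+1, x k - xs] <= s.
  apply: le_trans (cauchy_schwarz _ _) _.
  by rewrite -[s]mulr1; apply: ler_pM.
have c2 : '[u k.+1, w k - K (x k)] <= (`|us| + 1) * (Num.sqrt G * s).
  by apply: le_trans (cauchy_schwarz _ _) _; exact: ler_pM.
have c3 : C * `|K (x k) - w k| <= C * (Num.sqrt G * s).
  by rewrite distrC; exact: ler_wpM2l.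
have c4 : 0 <= (2 * L)^-1 * `|dF (x k) - dF xs| ^+ 2.
  by rewrite mulr_ge0 ?sqr_ge0// invr_ge0 ltW// mulr_gt0.
rewrite !mulrDl mul1r; move: c2 c3; rewrite !mulrDl mul1r !mulrA.
move: gap hvle c1 c4; move: (Num.sqrt G * s) (C * Num.sqrt G * s).
move: (Num.norm us * _ * _) (inner _ _) (inner _ _) (C * _) ((2 * L)^-1 * _).
by move=> *; lra.
Unshelve. all: end_near. Qed.

(** Summation by parts replaces the weighted differences of energies by a sum of
    [m] bounded energies; the weighted increments are bounded one by one. *)
Lemma weighted_gap_le : exists C, forall m,
  \sum_(0 <= j < m) j.+1%:R * split_gap j <= m%:R * C.
Proof.
have [CD CD0 hD] := D_rate.
pose a0 := gamma^-1 *: xs - dF xs.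
pose W k := energy (a k - a0) (u k).
pose Wmax := 2 * V 0%N + 2 * energy (as_ - a0) us.
have WW k : W k <= Wmax.
  rewrite /W -[a k - a0](subrKA as_) -{1}(subrK us (u k)).
  apply: le_trans (energyD_le _ _ _ _) _; rewrite lerD2r.
  by apply: ler_wpM2l => //; exact: (distance_dec rest (leq0n k)).
pose c := gamma ^+ 2 * L / 2.
have c0 : 0 <= c by rewrite divr_ge0// mulr_ge0 ?sqr_ge0// ltW.
exists (gamma / 2 * Wmax + c * CD) => m.
have bound j : j.+1%:R * split_gap j <=
    - (gamma / 2) * (j.+1%:R * (W j.+1 - W j)) + c * CD.
  have /(ler_wpM2l (ler0n R j.+1)) := value_gap_telescope F_lower RsE HsE (steps j).
  rewrite -/Psis -/(split_gap j) => /le_trans; apply.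
  have := ler_wpM2l c0 (hD j); rewrite /W -/a0 -/c -/(increment j).
  move: (energy (a j - a0) _) (energy (a j.+1 - a0) _) => s t.
  move=> h; rewrite [leLHS](_ : _ =
    - (gamma / 2) * (j.+1%:R * (t - s)) + c * (j.+1%:R * increment j)).
    by rewrite lerD2l.
  by ring.
apply: (@le_trans _ _ (\sum_(0 <= j < m)
    (- (gamma / 2) * (j.+1%:R * (W j.+1 - W j)) + c * CD))).
  by apply: ler_sum => j _; exact: bound.
rewrite big_split /= -mulr_sumr (summation_by_parts (W : nat -> R^o)).
rewrite sumr_const_nat subn0 [leRHS]mulrDr -[c * CD *+ m]mulr_natl lerD2r.
rewrite mulNr -mulrN opprB mulrCA; apply: ler_wpM2l.
  by rewrite divr_ge0// ltW.
apply: (@le_trans _ _ (\sum_(0 <= k < m) W k)).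
  rewrite gerBl; apply: mulr_ge0 => //; exact: energy_ge0.
rewrite mulr_natl -[m in _ *+ m]subn0 -sumr_const_nat.
by apply: ler_sum => k _; exact: WW.
Qed.

(** The residuals are the differences of a bounded sequence [y], so that
    summation by parts applies again. *)
Lemma weighted_residual_le : exists2 C, 0 <= C & forall m,
  `|\sum_(0 <= j < m) j.+1%:R *: (K (x j) - w j)| <= m%:R * C.
Proof.
pose y k := K (a k - as_) - defect (u k - us).
pose Y := 1 + 2 * eta * V 0%N.
have yY k : `|y k| <= Y.
  have h : `|y k - 0| ^+ 2 <= 2 * eta * V 0%N.
    rewrite subr0; apply: le_trans (coupled_norm_le _ _) _.
    apply: ler_wpM2l (distance_dec rest (leq0n k)).
    by rewrite mulr_ge0// ltW.
  by have := norm_le_sqr h; rewrite normr0 add0r.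
have Y0 : 0 <= Y by exact: le_trans (yY 0%N).
exists (gamma * (Y + Y)) => [|m]; first by apply: mulr_ge0; [exact: ltW|exact: addr_ge0].
rewrite (eq_bigr (fun j => - gamma *: (j.+1%:R *: (y j.+1 - y j)))); last first.
  move=> j _; have [_ _ _ wE] := steps j.
  rewrite {1}wE opprD addrA subrr add0r -scaleNr scalerA mulrC -scalerA.
  congr (_ *: (_ *: _)); rewrite /y subrACA -(linearB K) -defectB.
  by congr (K _ - defect _); rewrite subrACA subrr subr0.
rewrite -scaler_sumr summation_by_parts normrZ normrN gtr0_norm// mulrCA.
apply: ler_wpM2l; first exact: ltW.
rewrite mulrDr; apply: le_trans (ler_normB _ _) _; apply: lerD.
  by rewrite normrZ normr_nat; exact: ler_wpM2l.
apply: le_trans (ler_norm_sum _ _ _) _.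
rewrite mulr_natl -[m in _ *+ m]subn0 -sumr_const_nat.
by apply: ler_sum => k _; exact: yY.
Qed.

(** Jensen's inequality for each of the three functions, [H] being averaged over
    the points [w j]; the weights add up to the order of [m ^ 2], the two
    weighted sums to the order of [m]. *)
Lemma ergodic_rate : exists C, \forall n \near \oo, exists2 v,
  Psi (wavg x n.+1) = v%:E & 0 <= v - Psis <= C / n.+1%:R.
Proof.
have [rad [C [rad0 C0 Hle]]] := H_near.
have [Q hQ] := weighted_gap_le; have [Q' Q'0 hQ'] := weighted_residual_le.
exists (2 * (`|Q| + C * Q')); near=> n.
have k1 : `|K (wavg x n.+1) - K xs| <= rad.
  by near: n; apply: cvg_near rad0 _; apply: cvg_linear; exact: cvg_wavg.
have k2 : `|wavg w n.+1 - K xs| <= rad.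
  by near: n; apply: cvg_near rad0 _; exact: cvg_wavg.
set m := n.+1 in k1 k2 *; set Lam := \sum_(0 <= j < m) j.+1%:R : R.
have Lam0 : 0 < Lam by exact: wsum_gt0.
have LamV : Lam^-1 * m%:R <= 2 / m%:R.
  rewrite /Lam sum_succ natrM invfM mulrA mulrAC divfK ?pnatr_eq0//.
  by apply: ler_wpM2l => //; rewrite lef_pV2 ?posrE// ler_nat.
have hF := jensen F_convex (fun j => erefl (EFin (F (x j)))) n.
rewrite /= lee_fin -/m -/Lam in hF.
have := jensen Reg_convex RkE n; have := jensen H_convex HkE n.
rewrite -/m -/Lam.
case Hw : (H (wavg w m)) (proj1 H_proper (wavg w m)) => [hb||//] _ //.
case Rx : (Reg (wavg x m)) (proj1 Reg_proper (wavg x m)) => [rb||//] _ //.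
rewrite !lee_fin => hH hR.
have [hv hvE hvle] := Hle _ _ _ k1 k2 Hw.
have PE : Psi (wavg x m) = (F (wavg x m) + rb + hv)%:E.
  by rewrite /Psi /primal_objective hvE Rx -!EFinD.
exists (F (wavg x m) + rb + hv) => //.
have := at_rest_argmin (wavg x m); rewrite objective_at_rest PE lee_fin => lower.
rewrite subr_ge0 lower /=.
have gapE : Lam^-1 * \sum_(0 <= j < m) j.+1%:R * split_gap j =
    Lam^-1 * (\sum_(0 <= j < m) j.+1%:R * F (x j))
    + Lam^-1 * (\sum_(0 <= j < m) j.+1%:R * fine (Reg (x j)))
    + Lam^-1 * (\sum_(0 <= j < m) j.+1%:R * fine (H (w j))) - Psis.
  have PsE : Psis = Lam^-1 * \sum_(0 <= j < m) j.+1%:R * Psis.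
    by rewrite -mulr_suml mulrA mulVf ?mul1r// lt0r_neq0.
  rewrite [X in _ - X]PsE -!mulrDr -mulrBr -!big_split -sumrB /=.
  by congr (_ * _); apply: eq_bigr => j _; rewrite /split_gap; ring.
have resE : `|K (wavg x m) - wavg w m| <= Lam^-1 * (m%:R * Q').
  rewrite wavg_linear /wavg -scalerBr -sumrB normrZ gtr0_norm ?invr_gt0//.
  apply: ler_wpM2l; first by rewrite invr_ge0 ltW.
  under eq_bigr do rewrite -scalerBr.
  exact: hQ'.
have gapQ : Lam^-1 * \sum_(0 <= j < m) j.+1%:R * split_gap j
    <= 2 / m%:R * `|Q|.
  apply: (@le_trans _ _ (Lam^-1 * m%:R * `|Q|)); last exact: ler_wpM2r.
  rewrite -mulrA; apply: ler_wpM2l; first by rewrite invr_ge0 ltW.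
  by apply: le_trans (hQ m) _; apply: ler_wpM2l => //; exact: ler_norm.
have resQ : C * `|K (wavg x m) - wavg w m| <= 2 / m%:R * (C * Q').
  apply: le_trans (ler_wpM2l C0 resE) _.
  rewrite [leLHS](_ : _ = Lam^-1 * m%:R * (C * Q')); last by ring.
  by apply: ler_wpM2r LamV; exact: mulr_ge0.
rewrite mulrAC mulrDr; move: gapE gapQ resQ hF hH hR hvle.
move: (2 / m%:R * Num.norm Q) (2 / m%:R * (C * Q')) (C * _) (F (wavg x m)).
move: (Lam^-1 * (\sum_(0 <= j < m) _ * F _)).
move: (Lam^-1 * (\sum_(0 <= j < m) _ * fine (Reg _))).
move: (Lam^-1 * (\sum_(0 <= j < m) _ * fine (H _))).
move: (Lam^-1 * (\sum_(0 <= j < m) _ * split_gap _)) (Psis).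
by move=> *; lra.
Unshelve. all: end_near. Qed.

(** If [H] is smooth then the dual iterates are gradients of [H], hence
    cocoercivity of that gradient makes their squared distances to the dual
    solution summable, and with them the gaps in the objective. *)
Lemma smooth_gap_summable (LH : R) (h : U -> R) (dh : U -> U) : 0 < LH ->
  (forall v, H v = (h v)%:E) ->
  (forall v s, h s <= h v + '[dh v, s - v] + LH / 2 * `|s - v| ^+ 2) ->
  (forall v s, LH^-1 * `|dh v - dh s| ^+ 2 <= '[dh v - dh s, v - s]) ->
  (forall v s, subdifferential H v s -> s = dh v) ->
  exists v : nat -> R, [/\ forall k, Psi (x k) = (v k)%:E,
    forall k, Psis <= v k &
    exists C, forall n, \sum_(0 <= k < n) (v k - Psis) <= C].
Proof.
move=> LH0 Hh h_upper h_coco h_sub.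
pose v k := F (x k) + fine (Reg (x k)) + h (K (x k)).
have PE k : Psi (x k) = (v k)%:E.
  by rewrite /Psi /primal_objective Hh RkE -!EFinD.
exists v; split=> // [k|].
  by have := at_rest_argmin (x k); rewrite objective_at_rest PE lee_fin.
pose B k := '[(a k - gamma^-1 *: x k) - (as_ - gamma^-1 *: xs), x k - xs]
  + '[w k - K xs, u k.+1 - us] + '[dF (x k) - dF xs, x k - xs].
set G := 2 * gamma ^+ 2 * eta.
have bound k : v k - Psis <= (1 + LH / 2) * B k + (1 + LH) / 2 * G * increment k.
  have hg := value_gap F_lower RsE HsE (steps k); rewrite -/Psis in hg.
  have [_ wu _ _] := steps k; have [_ ws _ _] := rest.
  have c1 := coupling_identity (steps k) rest erefl erefl erefl.
  rewrite -/(B k) in c1.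
  have c2 := dual_pairing_le (steps k) rest; rewrite -/(B k) in c2.
  have c3 := h_coco (w k) (K xs).
  rewrite -(h_sub _ _ wu) -(h_sub _ _ ws) innerC in c3.
  have c4 := h_upper (w k) (K (x k)); rewrite -(h_sub _ _ wu) in c4.
  have c5 := residual_le (steps k); rewrite -/(increment k) -/G in c5.
  have c6 := young (- (w k - K (x k))) (u k.+1 - us) ltr01.
  rewrite invr1 !mul1r innerNl normrN in c6.
  have c7 : 0 <= (2 * L)^-1 * `|dF (x k) - dF xs| ^+ 2.
    by rewrite mulr_ge0 ?sqr_ge0// invr_ge0 ltW// mulr_gt0.
  rewrite -(opprB (w k)) normrN innerNr in c4.
  have c8 : `|u k.+1 - us| ^+ 2 <= LH * B k.
    by rewrite -ler_pdivrMl//; exact: le_trans c3 c2.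
  have c9 := ler_wpM2l (ltW (divr_gt0 LH0 (ltr0n R 2))) c5.
  rewrite Hh /= in hg; rewrite /v c1 in hg *.
  rewrite (_ : (1 + LH / 2) * B k = B k + 2^-1 * (LH * B k)); last by field.
  rewrite (_ : (1 + LH) / 2 * G * increment k =
    2^-1 * (G * increment k) + LH / 2 * (G * increment k)); last by field.
  move: hg c4 c5 c6 c7 c8 c9; move: (LH * B k) (B k) (G * increment k).
  move: ((2 * L)^-1 * _).
  move: (LH / 2 * Num.norm (w k - K (x k)) ^+ 2) (LH / 2 * _).
  move: (Num.norm (w k - K (x k)) ^+ 2) (Num.norm (u k.+1 - us) ^+ 2).
  move: (inner (u k.+1) _) (inner _ _) (h _) (h _) (F _) (fine _) (Psis).
  by move=> *; lra.
pose c1 := (1 + LH / 2) * gamma.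
pose c2 := (1 + LH / 2) * gamma * (gamma * L) + (1 + LH) / 2 * G.
have G0 : 0 <= G by rewrite /G !mulr_ge0 ?sqr_ge0// ltW.
have h10 : 0 <= 1 + LH / 2 by rewrite addr_ge0// divr_ge0// ltW.
have c10 : 0 <= c1 by rewrite mulr_ge0// ltW.
have c20 : 0 <= c2.
  apply: addr_ge0; apply: mulr_ge0 => //; first by rewrite mulr_ge0// ltW.
  by rewrite divr_ge0// addr_ge0// ltW.
have step k : v k - Psis <= c1 * (V k - V k.+1) + c2 * increment k.
  apply: le_trans (bound k) _.
  have := monotonicity_le_energy (steps k) rest; rewrite -/(B k) !subrr !subr0.
  rewrite -/(V k) -/(V k.+1) -/(increment k) ler_pdivrMl// => hB.
  have := ler_wpM2l h10 hB; rewrite /c1 /c2.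
  rewrite (_ : (1 + LH / 2) * (gamma * (V k - V k.+1 + gamma * L * increment k))
    = (1 + LH / 2) * gamma * (V k - V k.+1)
      + (1 + LH / 2) * gamma * (gamma * L) * increment k); last by ring.
  by rewrite (mulrDl (_ * gamma * _)) addrA lerD2r.
exists (c1 * V 0%N + c2 * (V 0%N / (1 - gamma * L / 2))) => n.
apply: (@le_trans _ _ (\sum_(0 <= k < n)
    (c1 * (V k - V k.+1) + c2 * increment k))).
  by apply: ler_sum => k _; exact: step.
rewrite big_split /= -!mulr_sumr; apply: lerD; apply: ler_wpM2l => //.
  rewrite (eq_bigr (fun k => - V k.+1 - - V k)); last first.
    by move=> k _; rewrite opprK addrC.
  by rewrite (telescope_sumr (fun k => - V k))// opprK addrC gerBl energy_ge0.
exact: (increment_sum rest).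
Qed.

End Rates.
End Trajectory.
End Iteration.

(** * PD3O with a constant step size *)

Theorem theorem1 (R : realType) (X U : euclideanType R)
    (K : {linear X -> U})
    (F : X -> R) (Reg : X -> \bar R) (H : U -> \bar R) (LF : R)
    (Reg_proper : proper_fun Reg) (Reg_closed : closed_fun Reg)
    (Reg_convex : econvex Reg)
    (H_proper : proper_fun H) (H_closed : closed_fun H) (H_convex : econvex H)
    (F_convex : convex_function setT (F : convex_lmodType X -> R^o))
    (LF_gt0 : 0 < LF) (F_smooth : L_smooth LF F)
    (standing : exists (x : X) (r : X) (h : U),
      [/\ subdifferential Reg x r, subdifferential H (K x) h &
          gradient F x + r + adjoint K h = 0])
    (gamma eta : R) (gamma_gt0 : 0 < gamma) (gamma_lt : gamma < 2 / LF)
    (eta_gt0 : 0 < eta) (eta_ge : opnorm K ^+ 2 <= eta)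
    (q0 : X) (u0 : U) (x q : nat -> X) (u : nat -> U)
    (iterates : PD3O F Reg H K (fun=> gamma) eta q0 u0 x q u)
    (Psi := primal_objective F Reg H K) :
  exists (xs : X) (us : U),
    [/\ x @ \oo --> xs, argmin Psi xs,
        u @ \oo --> us, argmin (dual_objective F Reg H K) us &
        (exists2 e : R, 0 < e &
           forall v, ball (K xs) e v -> {for v, continuous H}) ->
        [/\ elittleo (fun k => (Psi (x k) - Psi xs)%E)
              (fun k => (Num.sqrt k%:R)^-1),
            ebigO (fun k => let xbar := (2 / (k * k.+1)%:R) *:
                              \sum_(1 <= i < k.+1) i%:R *: x i in
                            (Psi xbar - Psi xs)%E)
              (fun k => k%:R^-1) &
            forall (L : R) (h : U -> R), 0 < L ->
              (forall v, H v = (h v)%:E) -> L_smooth L h ->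
              elittleo
                (fun k => (\big[Order.min/+oo]_(1 <= i < k.+1) Psi (x i)
                           - Psi xs)%E)
                (fun k => k%:R^-1)]].
Proof.
have [x0 [r0 [h0 [Rx0 Hx0 opt0]]]] := standing.
have dFE : forall y d, 'd (F : X -> R^o) y d = '[gradient F y, d] := gradientP F.
have lip := L_smooth_lip F_smooth; have Fc := econvex_EFin F_convex.
have diffF := F_smooth.1.
have lower := convex_smooth_lower diffF dFE LF_gt0 lip Fc.
have coco := gradient_cocoercive diffF dFE LF_gt0 lip Fc.
have adjK : forall y v, '[K y, v] = '[y, adjoint K v] := adjointP K.
have opn := opnorm_ge0 K.
have Kle y : `|K y| ^+ 2 <= eta * `|y| ^+ 2.
  apply: (@le_trans _ _ ((opnorm K * `|y|) ^+ 2)).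
    by rewrite lerXn2r ?nnegrE ?mulr_ge0//; exact: opnorm_le.
  by rewrite exprMn; apply: ler_wpM2r => //; exact: sqr_ge0.
have Ksle v : `|adjoint K v| ^+ 2 <= eta * `|v| ^+ 2.
  apply: (@le_trans _ _ ((opnorm K * `|v|) ^+ 2)).
    by rewrite lerXn2r ?nnegrE ?mulr_ge0//; exact: adjoint_norm_le.
  by rewrite exprMn; apply: ler_wpM2r => //; exact: sqr_ge0.
have gL : gamma * LF < 2 by rewrite -ltr_pdivlMr.
have gne : gamma != 0 by exact: lt0r_neq0.
have Rsub : exists y g, subdifferential Reg y g by exists x0, r0.
have Hsub : exists y g, subdifferential H y g by exists (K x0), h0.
pose Ks : {linear U -> X} := adjoint K.
have {}adjK : forall y v, '[K y, v] = '[y, Ks v] by [].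
have KsE v : adjoint K v = Ks v by [].
have {}Ksle v : `|Ks v| ^+ 2 <= eta * `|v| ^+ 2 by exact: Ksle.
pose dF := gradient F.
rewrite -/dF in lower coco lip opt0 dFE.
have dFG y : gradient F y = dF y by [].
have dualE : dual_objective F Reg H K =
    fun v => (conjugate (fun y => (F y)%:E + Reg y) (- Ks v)%R + conjugate H v)%E.
  by [].
have [q0E u0E iter] := iterates.
pose a k := q k - Ks (u k).
(* the point given by [prox_conjugate] *)
pose w k := (gamma * eta) *: (u k + eta^-1 *:
  K (gamma^-1 *: x k.+1 + q k.+1 - q k) - u k.+1).
have steps k : pd3o_step K Ks dF Reg H gamma eta (a k) (u k) (x k.+1) (w k)
    (a k.+1) (u k.+1).
  have [xE qE uE] := iter k; rewrite KsE in xE; rewrite dFG in qE.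
  split.
  - have := prox_subdiff (gamma *: (q k - Ks (u k))) Reg_proper Reg_closed
      Reg_convex Rsub gamma_gt0.
    by rewrite /= -xE scalerBr scalerA mulVf// scale1r.
  - have := prox_conjugate (u k + eta^-1 *:
      K (gamma^-1 *: x k.+1 + q k.+1 - q k)) H_proper H_closed H_convex Hsub
      (mulr_gt0 gamma_gt0 eta_gt0).
    by rewrite /= -uE.
  - by rewrite /a qE.
  - rewrite /w /a /defect; apply: inner_ext => v.
    rewrite !(linearB Ks) !(linearB K) !(linearD K) !(linearZ_LR K).
    by rewrite ?(linearB K) !innerE; field; rewrite gne lt0r_neq0.
have {}opt0 : r0 = - dF x0 - Ks h0.
  by move/eqP: opt0; rewrite KsE addrAC addrC addr_eq0 opprD => /eqP.
have rest0 : at_rest K Ks dF Reg H gamma eta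
    (gamma^-1 *: x0 - dF x0 - Ks h0) h0 x0.
  split=> //; last by rewrite !subrr /defect (linear0 Ks) (linear0 K) !(scaler0, subr0) addr0.
  by rewrite addrAC (addrAC (gamma^-1 *: x0)) subrr add0r -opt0.
have [as_ [us [xs [rest xcvg ucvg]]]] := iterates_cvg adjK Kle Ksle LF_gt0
  gamma_gt0 eta_gt0 gL coco lip Reg_proper H_proper Reg_closed H_closed
  steps rest0.
have xmin := at_rest_argmin adjK LF_gt0 Reg_proper H_proper lower rest.
have PsiE := objective_at_rest Reg_proper H_proper F rest.
set Psis := F xs + _ + _ in PsiE.
have [Rxs Hxs asE _] := rest.
exists xs, us; split=> //.
- by rewrite -(cvg_shiftS x).
- rewrite dualE; apply: (fenchel_dual_argmin (xs := xs) adjK _ H_proper _ Hxs).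
    split; first by move=> y; case: (Reg y) (proj1 Reg_proper y).
    have [y Ry] := proj2 Reg_proper; exists y.
    by case: (Reg y) (proj1 Reg_proper y) Ry.
  move=> y; case Ry : (Reg y) (proj1 Reg_proper y) => [r||//] _.
    have h1 := subdiff_ineq Reg_proper Rxs Ry; have h2 := lower xs y.
    have h3 : 0 <= (2 * LF)^-1 * `|dF y - dF xs| ^+ 2.
      by rewrite mulr_ge0 ?sqr_ge0// invr_ge0 ltW// mulr_gt0.
    rewrite -(fineK (subdiff_fin Reg_proper Rxs)) -!EFinD lee_fin.
    have h4 : '[as_ - gamma^-1 *: xs, y - xs] =
        - '[dF xs, y - xs] + '[- Ks us, y - xs].
      by rewrite asE !innerE; ring.
    move: h1 h2 h3; rewrite h4; move: (fine _) (F y) (F xs) (inner (dF xs) _).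
    by move: (inner (- Ks us) _) (_ * _ ^+ 2) => *; lra.
  by rewrite leey.
move=> [e e0 Hcont].
have H_near : exists rad C : R, [/\ 0 < rad, 0 <= C &
    forall v s t, `|v - K xs| <= rad -> `|s - K xs| <= rad -> H s = t%:E ->
    exists2 hv, H v = hv%:E & hv <= t + C * `|v - s|].
  apply: (convex_lipschitz H_proper H_convex Hxs).
  apply: continuous_bounded_near (subdiff_fin H_proper Hxs) _.
  by apply: Hcont; exact: ballxx.
have fE : Psi xs = Psis%:E by exact: PsiE.
rewrite fE; split.
- have [C hC] := last_iterate_rate adjK Kle Ksle LF_gt0 gamma_gt0 eta_gt0 gL coco
    Reg_proper H_proper steps lower rest xcvg ucvg H_near.
  have D0 k : 0 <= increment K Ks eta a u k by exact: (increment_ge0 adjK Ksle).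
  apply: (elittleo_sqrt D0 hC); apply: (nonincreasing_rate_o D0).
    exact: (increment_dec adjK Ksle LF_gt0 gamma_gt0 gL coco Reg_proper H_proper
      steps).
  exact: (increment_sum adjK Ksle LF_gt0 gamma_gt0 gL coco Reg_proper H_proper
    steps rest).
- have [C hC] := ergodic_rate adjK Kle Ksle LF_gt0 gamma_gt0 eta_gt0 gL coco
    Reg_proper H_proper steps lower Fc Reg_convex H_convex rest xcvg H_near.
  apply: (@ebigO_inv _ _ _ C); apply: filterS hC => n [v vE vC]; exists v => //.
  rewrite /= -vE; congr (Psi _).
  by rewrite /wavg sum_succ big_add1.
- move=> L h L0 Hh h_smooth.
  have hv : econvex (EFin \o h) by move=> t y z; rewrite /= -!Hh; exact: H_convex.
  have dhE : forall y d, 'd (h : U -> R^o) y d = '[gradient h y, d] := gradientP h.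
  have liph := L_smooth_lip h_smooth; have diffh := h_smooth.1.
  have desc := smooth_upper_bound diffh dhE liph.
  have coh := gradient_cocoercive diffh dhE L0 liph hv.
  move: coh desc; set dh := gradient h => coh desc.
  have hsub v s : subdifferential H v s -> s = dh v.
    move=> vs; apply: (subdiff_gradient L0 desc).
    by move=> y; rewrite -!Hh.
  have [v [vE vge [C sumC]]] := smooth_gap_summable adjK Kle Ksle LF_gt0 gamma_gt0
    eta_gt0 gL coco Reg_proper H_proper steps lower rest L0 Hh desc coh hsub.
  exact: (running_min_rate vE vge sumC).
Qed.
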